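(* Let $p>3$ be prime and $\alpha\in\mathbb{Z}_p^\times$. Let $$g_p(\alpha)=\frac{\Gamma_p(1+\frac12\alpha)\Gamma_p(1-\frac32\alpha)}{\Gamma_p(1+\alpha)\Gamma_p(1-\alpha)\Gamma_p(1-\frac12\alpha)^2},\qquad h_p(\alpha)=H_{\langle-\alpha\rangle_{p^2}}(p)+\frac12H_{\langle-\alpha/2\rangle_{p^2}}(p)-\frac12H_{\langle-3\alpha/2\rangle_{p^2}}(p),$$ and $S=\sum_{k=1}^{p-1}\frac{(\alpha)_k^3}{(k!)^3}H_k$. Then modulo $p^2$: $S\equiv2g_p(\alpha)h_p(\alpha)$ if $\langle-\alpha\rangle_p$ is even and $\langle-\alpha\rangle_p<2p/3$; $S\equiv g_p(\alpha)\big(-1+p(2-3\alpha_p^* )h_p(\alpha)\big)$ if $\langle-\alpha\rangle_p$ is even and $\langle-\alpha\rangle_p\geq2p/3$; $S\equiv g_p(\alpha)\big(-\frac13+p\alpha_p^*h_p(\alpha)\big)$ if $\langle-\alpha\rangle_p$ is odd and $\langle-\alpha\rangle_p<p/3$; $S\equiv-\frac{p\,g_p(\alpha)}{6}$ if $\langle-\alpha\rangle_p$ is odd and $\langle-\alpha\rangle_p\geq p/3$.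
   Context: $\mathbb{Z}_p^\times=\{x\in\mathbb{Z}_p:p\nmid x\}$. $(x)_k=x(x+1)\cdots(x+k-1)$. $H_k=\sum_{j=1}^k1/j$, and $H_n(p)=\sum_{1\leq k\leq n,\ p\nmid k}1/k$. $\langle x\rangle_{m}$ is the least nonnegative residue of $x\in\mathbb{Z}_p$ modulo $m$ (for $m=p$ or $p^2$), and $\alpha_p^*=(\alpha+\langle-\alpha\rangle_p)/p$. $\Gamma_p$ is Morita's $p$-adic Gamma function: $\Gamma_p(0)=1$, $\Gamma_p(n)=(-1)^n\prod_{1\leq k<n,\ p\nmid k}k$ for integers $n\geq1$, extended continuously to $\mathbb{Z}_p$. *)

(* Defs.v *)
From HB Require Import structures.
From mathcomp Require Import all_boot all_order all_algebra.
From mathcomp Require Import mathcomp_extra boolp classical_sets.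

Set Implicit Arguments.
Unset Strict Implicit.
Unset Printing Implicit Defensive.

Import GRing.Theory.
Local Open Scope ring_scope.

(* The p-adic integers, as the inverse limit of the rings Z/p^(n+1)Z: the     *)
(* n-th coordinate is the class modulo p^(n+1).  The indices are shifted by   *)
(* one because 'Z_m only denotes Z/mZ for m > 1.                              *)
Record padic_int (p : nat) := PadicInt {
  padic_coord :> forall n, 'Z_(p ^ n.+1);
  padic_coh : forall n, inZp (padic_coord n.+1) = padic_coord n }.

Lemma padic_ext p (x y : padic_int p) : (forall n, x n = y n) -> x = y.
Proof.
case: x y => [x cx] [y cy] /= exy.
have {}exy : x = y by apply: functional_extensionality_dep.
by case: _ / exy cy => cy; congr PadicInt; apply: Prop_irrelevance.
Qed.

Section Reduction.
Variables p n : nat.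
Let q := (p ^ n.+1)%N.
Let q' := (p ^ n.+2)%N.
Definition padic_red (x : 'Z_q') : 'Z_q := inZp x.

Lemma padic_trunc_dvd : ((Zp_trunc q).+2 %| (Zp_trunc q').+2)%N.
Proof.
rewrite /q /q'; case: p => [|[|m]]; first by rewrite !exp0n.
  by rewrite !exp1n.
rewrite !Zp_cast ?dvdn_exp2l //; exact: leq_trans (ltn_expl _ _).
Qed.

Lemma padic_red0 : padic_red 0 = 0.
Proof. by apply: val_inj; rewrite /= mod0n. Qed.
Lemma padic_red1 : padic_red 1 = 1.
Proof. by apply: val_inj. Qed.
Lemma padic_redD : {morph padic_red : x y / x + y}.
Proof.
by move=> x y; apply: val_inj; rewrite /= modn_dvdm ?padic_trunc_dvd ?modnDm.
Qed.
Lemma padic_redN : {morph padic_red : x / - x}.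
Proof.
move=> x; have /eqP := padic_redD x (- x).
by rewrite subrr padic_red0 eq_sym addrC addr_eq0 => /eqP.
Qed.
Lemma padic_redM : {morph padic_red : x y / x * y}.
Proof.
by move=> x y; apply: val_inj; rewrite /= modn_dvdm ?padic_trunc_dvd ?modnMm.
Qed.
Lemma padic_redV (x : 'Z_q') : x \is a GRing.unit ->
  padic_red x^-1 = (padic_red x)^-1.
Proof.
move=> ux; have rx : padic_red x * padic_red x^-1 = 1.
  by rewrite -padic_redM divrr // padic_red1.
have uy : padic_red x \is a GRing.unit.
  by apply/unitrPr; exists (padic_red x^-1).
by apply: (mulrI uy); rewrite rx divrr.
Qed.
End Reduction.

Section PadicRing.
Variable p : nat.
Implicit Types x y z : padic_int p.

HB.instance Definition _ := gen_eqMixin (padic_int p).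
HB.instance Definition _ := gen_choiceMixin (padic_int p).

Lemma padic_cohE x n : padic_red (x n.+1) = x n.
Proof. exact: padic_coh. Qed.

Definition padic_zero : padic_int p :=
  @PadicInt p (fun=> 0) (fun n => padic_red0 p n).
Definition padic_one : padic_int p :=
  @PadicInt p (fun=> 1) (fun n => padic_red1 p n).

Fact padic_add_coh x y n : padic_red (x n.+1 + y n.+1) = x n + y n.
Proof. by rewrite padic_redD !padic_cohE. Qed.
Definition padic_add x y := PadicInt (padic_add_coh x y).

Fact padic_opp_coh x n : padic_red (- x n.+1) = - x n.
Proof. by rewrite padic_redN padic_cohE. Qed.
Definition padic_opp x := PadicInt (padic_opp_coh x).

Fact padic_mul_coh x y n : padic_red (x n.+1 * y n.+1) = x n * y n.
Proof. by rewrite padic_redM !padic_cohE. Qed.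
Definition padic_mul x y := PadicInt (padic_mul_coh x y).

Fact padic_addA : associative padic_add.
Proof. by move=> x y z; apply: padic_ext => n /=; rewrite addrA. Qed.
Fact padic_addC : commutative padic_add.
Proof. by move=> x y; apply: padic_ext => n /=; rewrite addrC. Qed.
Fact padic_add0 : left_id padic_zero padic_add.
Proof. by move=> x; apply: padic_ext => n /=; rewrite add0r. Qed.
Fact padic_addN : left_inverse padic_zero padic_opp padic_add.
Proof. by move=> x; apply: padic_ext => n /=; rewrite addNr. Qed.

HB.instance Definition _ := GRing.isZmodule.Build (padic_int p)
  padic_addA padic_addC padic_add0 padic_addN.

Fact padic_mulA : associative padic_mul.
Proof. by move=> x y z; apply: padic_ext => n /=; rewrite mulrA. Qed.
Fact padic_mulC : commutative padic_mul.
Proof. by move=> x y; apply: padic_ext => n /=; rewrite mulrC. Qed.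
Fact padic_mul1 : left_id padic_one padic_mul.
Proof. by move=> x; apply: padic_ext => n /=; rewrite mul1r. Qed.
Fact padic_mulD : left_distributive padic_mul padic_add.
Proof. by move=> x y z; apply: padic_ext => n /=; rewrite mulrDl. Qed.
Fact padic_1neq0 : padic_one != 0.
Proof.
by apply/eqP => /(congr1 (fun x : padic_int p => x 0)) /eqP; rewrite oner_eq0.
Qed.

HB.instance Definition _ := GRing.Zmodule_isComNzRing.Build (padic_int p)
  padic_mulA padic_mulC padic_mul1 padic_mulD padic_1neq0.

Definition padic_unit : pred (padic_int p) :=
  fun x => `[< forall n, x n \is a GRing.unit >].

Fact padic_inv_coh x (ux : forall n, x n \is a GRing.unit) n :
  padic_red (x n.+1)^-1 = (x n)^-1.
Proof. by rewrite padic_redV // padic_cohE. Qed.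
Definition padic_inv x : padic_int p :=
  if pselect (forall n, x n \is a GRing.unit) is left ux
  then PadicInt (padic_inv_coh ux) else x.

Fact padic_mulV : {in padic_unit, left_inverse 1 padic_inv *%R}.
Proof.
move=> x /asboolP ux; rewrite /padic_inv; case: pselect => // vx.
by apply: padic_ext => n; apply: (mulVr (vx n)).
Qed.
Fact padic_unitP x y : y * x = 1 -> padic_unit x.
Proof.
move=> yx; apply/asboolP => n; apply/unitrPr; exists (y n).
by rewrite mulrC; apply: (congr1 (fun x : padic_int p => x n) yx).
Qed.
Fact padic_inv_out : {in [predC padic_unit], padic_inv =1 id}.
Proof.
by move=> x /asboolPn nx; rewrite /padic_inv; case: pselect.
Qed.

HB.instance Definition _ := GRing.ComNzRing_hasMulInverse.Build (padic_int p)
  padic_mulV padic_unitP padic_inv_out.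

Lemma padic_coordD x y n : (x + y) n = x n + y n. Proof. by []. Qed.
Lemma padic_coordN x n : (- x) n = - x n. Proof. by []. Qed.
Lemma padic_coordM x y n : (x * y) n = x n * y n. Proof. by []. Qed.
Lemma padic_coord1 n : (1 : padic_int p) n = 1. Proof. by []. Qed.
Lemma padic_coord0 n : (0 : padic_int p) n = 0. Proof. by []. Qed.
Lemma padic_coord_nat k n : (k%:R : padic_int p) n = k%:R.
Proof. by elim: k => // k IH; rewrite !mulrS padic_coordD IH. Qed.
End PadicRing.

Definition padic_eqmod p (m : nat) (x y : padic_int p) : Prop :=
  exists z : padic_int p, x - y = m%:R * z.

(* <x>_(p^n) *)
Definition padic_res p (n : nat) (x : padic_int p) : nat := (x n %% p ^ n)%N.

Definition padic_continuous p (f : padic_int p -> padic_int p) : Prop :=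
  forall x n, exists m, forall y,
    padic_eqmod (p ^ m) y x -> padic_eqmod (p ^ n) (f y) (f x).

Definition morita_nat (R : pzRingType) (p n : nat) : R :=
  (-1) ^+ n * \prod_(1 <= k < n | ~~ (p %| k)%N) k%:R.

(* Morita's p-adic Gamma function, meant for p an odd prime: the continuous   *)
(* extension to Z_p of morita_nat, which exists and is unique by              *)
(* morita_gammaP and morita_gamma_unique below.                               *)
Definition morita_gamma p : padic_int p -> padic_int p :=
  xget (fun=> 0) [set G | padic_continuous G /\
                          forall n, G n%:R = morita_nat (padic_int p) p n].

Definition pochhammer (R : pzRingType) (x : R) (k : nat) : R :=
  \prod_(0 <= i < k) (x + i%:R).

Definition harmonic (R : unitRingType) (n : nat) : R :=
  \sum_(1 <= j < n.+1) j%:R^-1.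

(* H_n(p).  Every inverse below, here and in the theorem, is that of a unit of *)
(* Z_p when p > 3: see padic_nat_unit and morita_gamma_unit.                  *)
Definition harmonic_coprime (R : unitRingType) (p n : nat) : R :=
  \sum_(1 <= k < n.+1 | ~~ (p %| k)%N) k%:R^-1.

(* alpha_p^* = (alpha + <-alpha>_p) / p; see padic_starP and padic_mulpI for  *)
(* the existence and the uniqueness of this quotient in Z_p.                  *)
Definition padic_star p (alpha : padic_int p) : padic_int p :=
  xget 0 [set b | p%:R * b = alpha + (padic_res 1 (- alpha))%:R].

Definition g_p p (alpha : padic_int p) : padic_int p :=
  let G := @morita_gamma p in
  G (1 + alpha / 2%:R) * G (1 - 3%:R * alpha / 2%:R)
  / (G (1 + alpha) * G (1 - alpha) * G (1 - alpha / 2%:R) ^+ 2).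

Definition h_p p (alpha : padic_int p) : padic_int p :=
  let H := harmonic_coprime (padic_int p) p in
  H (padic_res 2 (- alpha))
  + 2%:R^-1 * H (padic_res 2 (- (alpha / 2%:R)))
  - 2%:R^-1 * H (padic_res 2 (- (3%:R * alpha / 2%:R))).

Definition harmonic_sum p (alpha : padic_int p) : padic_int p :=
  \sum_(1 <= k < p) pochhammer alpha k ^+ 3 / k`!%:R ^+ 3
                    * harmonic (padic_int p) k.

Section Facts.
Variable p : nat.
Hypothesis pr_p : prime p.
Implicit Types x y : padic_int p.

Lemma padic_powgt1 n : (1 < p ^ n.+1)%N.
Proof. by rewrite -(exp1n n.+1) ltn_exp2r // prime_gt1. Qed.

Lemma padic_trunc n : (Zp_trunc (p ^ n.+1)).+2 = (p ^ n.+1)%N.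
Proof. by rewrite Zp_cast // padic_powgt1. Qed.

Lemma Zq_inZp n k : (inZp k : 'Z_(p ^ n.+1)) = (k %% p ^ n.+1)%N :> nat.
Proof. by rewrite /=; congr (_ %% _)%N; exact: padic_trunc. Qed.
Lemma Zq_add n (a b : 'Z_(p ^ n.+1)) : a + b = ((a + b) %% p ^ n.+1)%N :> nat.
Proof. by rewrite /=; congr (_ %% _)%N; exact: padic_trunc. Qed.
Lemma Zq_mul n (a b : 'Z_(p ^ n.+1)) : a * b = ((a * b) %% p ^ n.+1)%N :> nat.
Proof. by rewrite /=; congr (_ %% _)%N; exact: padic_trunc. Qed.

Lemma padic_coord_lt x n : (x n < p ^ n.+1)%N.
Proof. by rewrite -[X in (_ < X)%N]padic_trunc. Qed.

Lemma padic_coord_mod x n m : (n <= m)%N -> (x m %% p ^ n.+1)%N = x n.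
Proof.
elim: m => [|m IH].
  by rewrite leqn0 => /eqP ->; rewrite modn_small // padic_coord_lt.
rewrite leq_eqVlt => /orP [/eqP -> |]; first by rewrite modn_small // padic_coord_lt.
rewrite ltnS => nm; rewrite -(IH nm) -(padic_cohE x m).
by rewrite Zq_inZp modn_dvdm // dvdn_exp2l.
Qed.

Lemma Zp_natE n k : (k%:R : 'Z_(p ^ n.+1)) = (k %% p ^ n.+1)%N :> nat.
Proof. by rewrite val_Zp_nat // padic_powgt1. Qed.

Lemma padic_eqmod_nat n x (r : nat) :
  (x n = r %[mod p ^ n])%N -> padic_eqmod (p ^ n) x r%:R.
Proof.
move=> xr; set y := x - r%:R.
have yE : ((y n : nat) %% p ^ n)%N = 0%N.
  have : (y n + r%:R)%R = x n by rewrite -padic_coord_nat -padic_coordD subrK.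
  move/(congr1 (@nat_of_ord _)); rewrite Zq_add => e.
  have : (y n + r = 0 + r %[mod p ^ n])%N.
    rewrite add0n -xr -e modn_dvdm ?dvdn_exp2l // Zp_natE.
    by apply/eqP; rewrite eqn_modDl modn_dvdm ?dvdn_exp2l.
  by move/eqP; rewrite eqn_modDr mod0n => /eqP.
have yd k : (p ^ n %| y (k + n)%N)%N.
  rewrite /dvdn -(@modn_dvdm (p ^ n.+1)) ?dvdn_exp2l //.
  by rewrite padic_coord_mod ?leq_addl // yE.
have pn0 : (0 < p ^ n)%N by rewrite expn_gt0 prime_gt0.
pose zc k : 'Z_(p ^ k.+1) := inZp (y (k + n)%N %/ p ^ n)%N.
have zcoh k : inZp (zc k.+1) = zc k.
  apply: ord_inj; rewrite !Zq_inZp modn_dvdm ?dvdn_exp2l //.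
  have e := padic_coord_mod y (leqnSn (k + n)).
  rewrite -e; set Y := nat_of_ord (y _).
  have dY : (p ^ n %| Y)%N by apply: (yd k.+1).
  have [c ec] : exists c, Y = (c * p ^ (k + n).+1 + Y %% p ^ (k + n).+1)%N.
    by exists (Y %/ p ^ (k + n).+1)%N; rewrite -divn_eq.
  rewrite [in LHS]ec -addSn expnD mulnA divnDl ?dvdn_mull //.
  by rewrite mulnK // modnMDl.
exists (PadicInt zcoh); apply: padic_ext => k; apply: ord_inj.
rewrite padic_coordM padic_coord_nat Zq_mul Zp_natE -/y.
have -> : PadicInt zcoh k = zc k by [].
rewrite Zq_inZp modnMm.
by rewrite mulnC divnK ?yd // padic_coord_mod ?leq_addr.
Qed.

Lemma padic_eqmod_coord n x y :
  padic_eqmod (p ^ n) x y -> (x n = y n %[mod p ^ n])%N.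
Proof.
case=> z /(congr1 (fun t : padic_int p => t n)).
rewrite padic_coordM padic_coord_nat padic_coordD => /(congr1 (+%R^~ (y n))).
rewrite padic_coordN subrK => ->; rewrite Zq_add Zq_mul Zp_natE.
rewrite !modn_dvdm ?dvdn_exp2l // -modnDml !modn_dvdm ?dvdn_exp2l //.
by rewrite -modnMml modn_dvdm ?dvdn_exp2l // modnn mul0n mod0n add0n.
Qed.

Lemma padic_resP n x :
  (padic_res n x < p ^ n)%N /\ padic_eqmod (p ^ n) x (padic_res n x)%:R.
Proof.
split; first by rewrite ltn_mod expn_gt0 prime_gt0.
by apply: padic_eqmod_nat; rewrite modn_mod.
Qed.

Lemma padic_eqmodxx m x : padic_eqmod m x x.
Proof. by exists 0; rewrite mulr0 subrr. Qed.
Lemma padic_eqmod_sym m x y : padic_eqmod m x y -> padic_eqmod m y x.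
Proof. by case=> z e; exists (- z); rewrite mulrN -e opprB. Qed.
Lemma padic_eqmod_trans m x y z :
  padic_eqmod m x y -> padic_eqmod m y z -> padic_eqmod m x z.
Proof.
by case=> a ea [b eb]; exists (a + b); rewrite mulrDr -ea -eb addrA subrK.
Qed.

Lemma padic_eqmodP n x y :
  padic_eqmod (p ^ n) x y <-> (x n = y n %[mod p ^ n])%N.
Proof.
split=> [|e]; first exact: padic_eqmod_coord.
apply: padic_eqmod_trans (_ : padic_eqmod _ (x n : nat)%:R y).
  exact: padic_eqmod_nat.
by apply/padic_eqmod_sym/padic_eqmod_nat.
Qed.

Lemma padic_eqmod_eq x y : (forall n, padic_eqmod (p ^ n) x y) -> x = y.
Proof.
move=> e; apply: padic_ext => n; apply: val_inj => /=.
rewrite -(padic_coord_mod x (leqnSn n)) -(padic_coord_mod y (leqnSn n)).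
exact/padic_eqmodP.
Qed.

Lemma padic_mulpI x y : p%:R * x = p%:R * y -> x = y.
Proof.
move=> e; apply: padic_ext => n; apply: val_inj => /=.
have := congr1 (fun t : padic_int p => nat_of_ord (t n.+1)) e.
rewrite !padic_coordM !padic_coord_nat !Zq_mul Zp_natE !modnMml.
move=> {}e.
rewrite -(padic_coord_mod x (leqnSn n)) -(padic_coord_mod y (leqnSn n)).
by apply/eqP; rewrite -(eqn_pmul2l (prime_gt0 pr_p)) !muln_modr -expnS; apply/eqP.
Qed.

Lemma padic_starP alpha :
  p%:R * @padic_star p alpha = alpha + (padic_res 1 (- alpha))%:R.
Proof.
rewrite /padic_star; case: xgetP => // /(_ _) nex.
have [_ [z ez]] := padic_resP 1 (- alpha).
case: (nex (- z)); rewrite /= mulrN.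
by move: ez; rewrite expn1 => <-; rewrite opprB opprK addrC.
Qed.

Lemma padic_Zunit n (k : nat) :
  ((k%:R : 'Z_(p ^ n.+1)) \is a GRing.unit) = ~~ (p %| k)%N.
Proof. by rewrite unitZpE ?padic_powgt1 // coprime_pexpl // prime_coprime. Qed.

Lemma padic_unitE x : x \is a GRing.unit <-> ~ padic_eqmod p x 0.
Proof.
have dv n : (p %| x n)%N <-> padic_eqmod p x 0.
  have h0 m : (x m %% p)%N = x 0%N.
    apply: etrans (padic_coord_mod x (leq0n m)).
    by congr (_ %% _)%N; rewrite expn1.
  rewrite /dvdn h0; have := padic_eqmodP 1 x 0.
  have -> : (x 1 %% p ^ 1)%N = x 0%N by exact: padic_coord_mod.
  have e1 : padic_eqmod (p ^ 1) x 0 <-> padic_eqmod p x 0 by rewrite expn1.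
  rewrite padic_coord0 mod0n e1 => e; split=> [/eqP /e //|/e ->]; exact: eqxx.
rewrite -[x \is a GRing.unit]/(padic_unit x); split=> [/asboolP ux|nx].
  by rewrite -(dv 0); apply/negP; rewrite -(padic_Zunit 0) natr_Zp.
by apply/asboolP => n; rewrite -(natr_Zp (x n)) padic_Zunit; apply/negP; rewrite dv.
Qed.

Lemma padic_nat_unit (k : nat) :
  ((k%:R : padic_int p) \is a GRing.unit) = ~~ (p %| k)%N.
Proof.
rewrite -(padic_Zunit 0); apply/asboolP/idP => [/(_ 0)|u n].
  by rewrite padic_coord_nat.
by rewrite padic_coord_nat padic_Zunit -(padic_Zunit 0).
Qed.

Hypothesis odd_p : (2 < p)%N.

Section Wilson.
Variable n : nat.
Let q := (p ^ n.+1)%N.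
Let q_gt1 : (1 < q)%N := padic_powgt1 n.

Lemma padic_sqr1 (x : 'Z_q) : x * x = 1 -> x = 1 \/ x = -1.
Proof.
move=> xx; have : (x - 1) * (x + 1) = 0.
  by rewrite mulrDr mulr1 mulrBl mul1r xx addrA subrK subrr.
have natE (k : nat) : (k%:R : 'Z_q) = 0 <-> (q %| k)%N.
  rewrite /dvdn -Zp_natE; split=> [-> //|/eqP e]; exact: val_inj.
have x1E : x - 1 = (x + q.-1)%N%:R.
  rewrite natrD natr_Zp; congr (_ + _).
  apply/eqP; rewrite eq_sym -subr_eq0 opprK natr1 prednK ?(ltnW q_gt1) //.
  by apply/eqP/natE.
have x2E : x + 1 = (x + 1)%N%:R by rewrite natrD natr_Zp.
rewrite x1E x2E -natrM => /natE.
have [p1|p1] := boolP (p %| x + 1)%N.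
  have np : ~~ (p %| x + q.-1)%N.
    apply/negP => p2; have : (p %| 2)%N.
      have pq : (p %| q)%N by rewrite /q expnS dvdn_mulr.
      have e : (x + q.-1 + 2 = x + 1 + q)%N.
        rewrite -!addnA; congr (_ + _)%N.
        by rewrite addn2 add1n prednK // ltnW.
      by rewrite -(dvdn_addr _ p2) e dvdn_add.
    by move=> /dvdn_leq-/(_ isT); rewrite leqNgt odd_p.
  rewrite Gauss_dvdr; last by rewrite coprime_pexpl // prime_coprime.
  by move/natE; rewrite -x2E => /eqP; rewrite addr_eq0 => /eqP; right.
rewrite Gauss_dvdl; last by rewrite coprime_pexpl // prime_coprime.
by move/natE; rewrite -x1E => /eqP; rewrite subr_eq0 => /eqP; left.
Qed.

Lemma padic_wilson : \prod_(x : 'Z_q | x \is a GRing.unit) x = -1.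
Proof.
have n11 : (1 : 'Z_q) != -1.
  have q_gt2 : (2 < q)%N.
    by rewrite (leq_trans odd_p) // -{1}(expn1 p) leq_exp2l ?prime_gt1.
  rewrite -subr_eq0 opprK -[1 + 1]/(2%:R); apply/eqP.
  by move/(congr1 (@nat_of_ord _)); rewrite Zp_natE modn_small.
rewrite (bigID (fun x : 'Z_q => x == x^-1)) /=.
rewrite (eq_bigl (fun x : 'Z_q => (x == 1) || (x == -1))); last first.
  move=> x; apply/andP/orP => [[ux /eqP e]|].
    by case: (@padic_sqr1 x) => [|->|->]; rewrite ?eqxx; auto;
       rewrite {2}e divrr.
  by case=> /eqP ->; rewrite ?unitrN1 ?unitr1 ?invrN ?invr1.
rewrite (bigD1 1) //= (bigD1 (-1)) /=; last by rewrite eqxx orbT eq_sym.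
rewrite big1 => [|x]; last by case: (x == 1); case: (x == -1).
rewrite mulr1 mul1r (bigID (fun x : 'Z_q => (x < x^-1)%N)) /=.
rewrite [X in _ * (_ * X)](reindex_inj invr_inj) /=.
rewrite [X in _ * (_ * X)](eq_bigl
  (fun x : 'Z_q => (x \is a GRing.unit) && (x != x^-1) && (x < x^-1)%N)).
  rewrite -big_split big1 ?mulr1 // => x /andP [/andP [ux _] _].
  exact: divrr.
move=> x; rewrite unitrV invrK eq_sym -leqNgt leq_eqVlt.
by rewrite -(inj_eq val_inj x) /=; case: ltngtP; rewrite ?andbF.
Qed.

Let F m : 'Z_q := \prod_(0 <= k < m | ~~ (p %| k)%N) k%:R.

Let FS m : F m.+1 = F m * (if (p %| m)%N then 1 else m%:R).
Proof.
by rewrite /F big_mkcond big_nat_recr //= -big_mkcond; case: (p %| m)%N.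
Qed.

Let Zqq : (q%:R : 'Z_q) = 0.
Proof. by apply: ord_inj; rewrite Zp_natE modnn. Qed.

Let Fq : F q = -1.
Proof.
transitivity (F (Zp_trunc q).+2); first by congr F; rewrite padic_trunc.
rewrite -padic_wilson /F big_mkord; apply: eq_big => i.
  by rewrite -(padic_Zunit n i) natr_Zp.
by move=> _; rewrite natr_Zp.
Qed.

Let Fadd m : F (m + q)%N = - F m.
Proof.
elim: m => [|m IH]; first by rewrite add0n Fq /F big_nil.
have pq : (p %| q)%N by rewrite /q expnS dvdn_mulr.
by rewrite addSn !FS IH mulNr dvdn_addl // natrD Zqq addr0.
Qed.

Lemma morita_natE m : morita_nat 'Z_q p m = (-1) ^+ m * F m.
Proof.
congr (_ * _); case: m => [|m]; first by rewrite /F !big_nil.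
by rewrite /F [in RHS]big_ltn_cond //= dvdn0.
Qed.

Lemma morita_nat_mod a b : (a = b %[mod q])%N ->
  morita_nat 'Z_q p a = morita_nat 'Z_q p b.
Proof.
have odd_q : odd q.
  by rewrite /q oddX; case: (even_prime pr_p) odd_p => [->|->].
have H m c : morita_nat 'Z_q p (c * q + m)%N = morita_nat 'Z_q p m.
  elim: c => // c IH; rewrite -{}IH mulSn -addnA addnC !morita_natE Fadd.
  by rewrite exprD -[X in _ * X * _]signr_odd odd_q expr1 mulrN1 mulrNN.
by move=> ab; rewrite (divn_eq a q) (divn_eq b q) !H ab.
Qed.
End Wilson.

Lemma morita_coord n k :
  (morita_nat (padic_int p) p k) n = morita_nat 'Z_(p ^ n.+1) p k.
Proof.
rewrite /morita_nat padic_coordM; congr (_ * _).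
  by elim: k => // k IH; rewrite !exprS padic_coordM IH.
rewrite (big_morph (fun x : padic_int p => x n) (fun x y => padic_coordM x y n)
  (padic_coord1 p n)).
by apply: eq_bigr => i _; rewrite padic_coord_nat.
Qed.

Theorem morita_gammaP : padic_continuous (@morita_gamma p) /\
  forall n, morita_gamma n%:R = morita_nat (padic_int p) p n.
Proof.
rewrite /morita_gamma; case: xgetP => [_ -> //|nex].
pose Gc x n := morita_nat 'Z_(p ^ n.+1) p (x n).
have Gcoh x n : inZp (Gc x n.+1) = Gc x n.
  rewrite /Gc -morita_coord padic_coh morita_coord; apply: morita_nat_mod.
  by rewrite padic_coord_mod // modn_small // padic_coord_lt.
case: (nex (fun x => PadicInt (Gcoh x))); split.
  move=> x n; exists n => y /padic_eqmodP e.
  case: n e => [|n] e; first by apply/padic_eqmodP; rewrite !modn1.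
  have eG : Gc y n = Gc x n.
    apply: morita_nat_mod; rewrite -(padic_coord_mod x (leqnSn n)).
    by rewrite -(padic_coord_mod y (leqnSn n)) e.
  apply/padic_eqmodP => //.
  have EG z : (PadicInt (Gcoh z) n.+1 %% p ^ n.+1)%N = Gc z n.
    by rewrite padic_coord_mod.
  by rewrite !EG eG.
move=> m; apply: padic_ext => n; rewrite morita_coord /= /Gc.
by apply: morita_nat_mod; rewrite padic_coord_nat Zp_natE modn_mod.
Qed.

Theorem morita_gamma_unique (G : padic_int p -> padic_int p) :
  padic_continuous G -> (forall n, G n%:R = morita_nat (padic_int p) p n) ->
  G = @morita_gamma p.
Proof.
have [Cg Eg] := morita_gammaP.
move=> CG EG; apply: funext => x; apply: padic_eqmod_eq => n.
have [m1 h1] := CG x n; have [m2 h2] := Cg x n.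
pose r := padic_res (maxn m1 m2) x.
have hr m : (m <= maxn m1 m2)%N -> padic_eqmod (p ^ m) r%:R x.
  move=> lem; have [_ [z ez]] := padic_resP (maxn m1 m2) x.
  apply: padic_eqmod_sym; exists ((p ^ (maxn m1 m2 - m))%:R * z).
  by rewrite mulrA -natrM -expnD subnKC.
apply: padic_eqmod_trans (padic_eqmod_sym (h1 _ (hr _ (leq_maxl _ _)))) _.
by rewrite EG -Eg; apply: h2; apply: hr; apply: leq_maxr.
Qed.

Lemma morita_gamma_unit x : morita_gamma x \is a GRing.unit.
Proof.
have [Cg Eg] := morita_gammaP; have [m hm] := Cg x 1.
have [_ /padic_eqmod_sym /hm] := padic_resP m x.
rewrite Eg expn1 => e; apply/padic_unitE => g0.
move: (padic_eqmod_trans e g0); apply/padic_unitE.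
rewrite /morita_nat unitrMl ?unitrX ?unitrN1 //.
apply: (big_ind (fun y : padic_int p => y \is a GRing.unit)) => [|a b ua ub|k].
- exact: unitr1.
- by rewrite unitrMl.
- by rewrite padic_nat_unit.
Qed.
End Facts.

(* Main.v *)
(** Write [alpha = - a + p t] with [a = <- alpha>_p].  The terms of the sum with
[k > a] vanish modulo [p ^ 2], and modulo [p ^ 2] the others are, up to a factor
[-6], the derivatives at [xi = 0] of the terms of Dixon's well-poised series with
parameters [alpha + 2 xi], [alpha + p t - 2 xi], [- a].  The replacement is exact
except for [t p E'], where [E'] is a sum of second-order harmonic numbers that only
matters modulo [p]: it is zero when [a] is odd, by the symmetry [k -> a - k], and
comes from the perturbation [- a, - a + v, - a - v] of the series, summed with
[y = v ^ 2], when [a] is even.  Dixon's theorem gives the perturbed series as a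
quotient of products; at most one factor of each product is divisible by [p].
The remaining factors form a quotient of values of [Gamma_p] which is [g_p(alpha)]
modulo [p ^ 2], because [Gamma_p (y + p t) Gamma_p (y - p t) = Gamma_p (y) ^ 2]
modulo [p ^ 2], and whose logarithmic derivative is [- 6 h_p(alpha)] up to a term
that cancels [E'].  The four cases are the four possible sets of factors
divisible by [p].

Everything is computed in [Z / p ^ 4]: the infinitesimal [xi] is [p ^ 2], whose
square is zero, and a congruence modulo [p ^ 2] is an equality multiplied by
[p ^ 2]. *)
From HB Require Import structures.
Require Import Defs.
From mathcomp Require Import all_boot all_order all_algebra.
From mathcomp Require Import ring zify.
Set Implicit Arguments.
Unset Strict Implicit.
Unset Printing Implicit Defensive.
Import Order.TTheory GRing.Theory Num.Theory.
Local Open Scope ring_scope.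

(** * Terminating Dixon sums *)

Lemma pochhammerS (R : pzRingType) (x : R) k :
  pochhammer x k.+1 = pochhammer x k * (x + k%:R).
Proof. by rewrite /pochhammer big_nat_recr. Qed.

Lemma pochhammer0 (R : pzRingType) (x : R) : pochhammer x 0 = 1.
Proof. by rewrite /pochhammer big_nil. Qed.

Lemma rmorph_pochhammer (R S : pzRingType) (f : {rmorphism R -> S}) x k :
  f (pochhammer x k) = pochhammer (f x) k.
Proof.
by rewrite rmorph_prod; apply: eq_bigr => i _; rewrite rmorphD rmorph_nat.
Qed.

Lemma pochhammer_neq0 (R : idomainType) (x : R) k :
  (forall i, (i < k)%N -> x + i%:R != 0) -> pochhammer x k != 0.
Proof.
elim: k => [|k IH] h; first by rewrite pochhammer0 oner_eq0.
by rewrite pochhammerS mulf_neq0 ?h // IH // => i ik; rewrite h // ltnW.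
Qed.

Lemma pochhammer_head (R : pzRingType) (x : R) k :
  pochhammer x k.+1 = x * pochhammer (x + 1) k.
Proof.
rewrite /pochhammer big_nat_recl // addr0; congr (_ * _).
by apply: eq_bigr => i _; rewrite mulrS addrA.
Qed.

Section Dixon.
Variables (F : numFieldType) (c B : F).
Let A := 2%:R * c.

(** The term of [3F2(A, B, -n; 1+A-B, 1+A+n; 1)], with [(-n)_k / k!] written as a signed binomial
    coefficient. Taking [c = A/2] as parameter keeps halves out of Dixon's product formula. *)
Definition dixon_term n k : F :=
  (-1) ^+ k * 'C(n, k)%:R * pochhammer A k * pochhammer B k
  / (pochhammer (1 + A - B) k * pochhammer (1 + A + n%:R) k).

Let G n k : F :=
  if k is j.+1 then
    2%:R^-1 * (1 + A + n%:R) * (-1) ^+ j * 'C(n, j)%:R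
    * pochhammer A j.+1 * pochhammer B j.+1
    / (pochhammer (1 + A - B) j * pochhammer (1 + A + n%:R) j.+1)
  else 0.

(* The Wilf-Zeilberger certificate of Dixon's summation *)
Lemma dixon_certificate n k : (k <= n.+1)%N ->
    (forall i, (i <= n)%N -> 1 + A - B + i%:R != 0) ->
    (forall i, (i <= n.*2.+2)%N -> 1 + A + i%:R != 0) ->
  (1 + c + n%:R) * (1 + A - B + n%:R) * dixon_term n.+1 k
  - (1 + A + n%:R) * (1 + c - B + n%:R) * dixon_term n k
  = G n k.+1 - G n k.
Proof.
move=> kn hB hA.
have nA : 1 + A + n%:R != 0 by apply: hA; lia.
have shift j : pochhammer (1 + A + n.+1%:R) j =
    pochhammer (1 + A + n%:R) j * (1 + A + n%:R + j%:R) / (1 + A + n%:R).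
  apply: (mulfI nA); rewrite [RHS]mulrC mulfVK // -pochhammerS.
  by rewrite pochhammer_head -[1 + A + n%:R + 1]addrA natr1.
have hp : pochhammer (1 + A + n%:R) k.+1 != 0.
  by apply: pochhammer_neq0 => i ik; rewrite -addrA -natrD hA //; lia.
have hkA : 1 + A + n%:R + k%:R != 0 by rewrite -addrA -natrD hA //; lia.
have hpk : pochhammer (1 + A + n%:R) k != 0.
  by apply: contraNneq hp => e; rewrite pochhammerS e mul0r.
have hBk : pochhammer (1 + A - B) k != 0.
  by apply: pochhammer_neq0 => i ik; rewrite hB //; lia.
rewrite /dixon_term /G shift.
(* [G] is set to [0] at [k = 0], so this case is checked apart; otherwise every term is a rational
   multiple of its values at the predecessor of [k]. *)
case: k => [|k] in kn hp hkA hpk hBk *.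
  rewrite !bin0 !pochhammerS !pochhammer0 /A in nA hkA *.
  by field; rewrite /= ?addr0 in hkA *.
have b1 : 'C(n, k.+1)%:R = (n%:R - k%:R) * 'C(n, k)%:R / k.+1%:R :> F.
  apply: (canRL (mulfK _)); first by rewrite pnatr_eq0.
  by rewrite mulrC -natrM mul_bin_left natrM natrB.
have kn0 : k.+1%:R != 0 :> F by rewrite pnatr_eq0.
rewrite binS natrD b1 !(pochhammerS _ k.+1) (exprS _ k) in hp *.
have hBk' : 1 + A - B + k%:R != 0 by rewrite hB.
have hBk0 : pochhammer (1 + A - B) k != 0.
  by apply: contraNneq hBk => e; rewrite pochhammerS e mul0r.
rewrite !pochhammerS in hBk *.
have hK : pochhammer (1 + A + n%:R) k * (1 + A + n%:R + k%:R) != 0.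
  by rewrite -pochhammerS.
move: hBk0 hBk' hK hkA nA kn0; rewrite -natr1.
move: (pochhammer A k) (pochhammer B k) (pochhammer (1 + A - B) k)
  (pochhammer (1 + A + n%:R) k)
  ((-1) ^+ k : F) ('C(n, k)%:R : F) (k%:R : F) (n%:R : F) => a1 a2 a3 a4 a5 a6 x y.
rewrite /A mulf_eq0 negb_or => h1 h2 /andP[h3 h4] h5 h6 h7.
by field; rewrite h1 h2 h3 h4 h5 h6 h7.
Qed.

(** Summed over [k <= n+1] the certificate telescopes to [0], since [G] vanishes at [k = 0] and
    contains ['C(n, n+1)] at the upper end. This is a two-term recurrence in [n]. *)
Lemma dixon_sum n :
    (forall i, (i < n)%N -> 1 + A - B + i%:R != 0) ->
    (forall i, (i <= n.*2)%N -> 1 + A + i%:R != 0) ->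
  (\sum_(0 <= k < n.+1) dixon_term n k)
    * (pochhammer (1 + c) n * pochhammer (1 + A - B) n)
  = pochhammer (1 + A) n * pochhammer (1 + c - B) n.
Proof.
elim: n => [_ _|n IH hB hA].
  by rewrite big_nat1 /dixon_term !pochhammer0 bin0 expr0 !mulr1 divr1.
have {}IH := IH (fun i lin => hB i (ltnW lin)) (fun i lin => hA i (leqW (leqW lin))).
have : \sum_(0 <= k < n.+2) ((1 + c + n%:R) * (1 + A - B + n%:R) * dixon_term n.+1 k
  - (1 + A + n%:R) * (1 + c - B + n%:R) * dixon_term n k) = 0.
  rewrite (eq_big_nat _ _ (F2 := fun k => G n k.+1 - G n k)) => [|k /andP[_ kn]].
    by rewrite telescope_sumr // /G bin_small // mulr0 !mul0r subr0.
  exact: dixon_certificate.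
rewrite sumrB -!mulr_sumr => /eqP; rewrite subr_eq0 => /eqP e.
rewrite !pochhammerS mulrACA [LHS]mulrC -!mulrA.
move: e; rewrite [X in _ = _ * X -> _]big_nat_recr //=.
rewrite (_ : dixon_term n n.+1 = 0) ?addr0; last first.
  by rewrite /dixon_term bin_small // mulr0 !mul0r.
move: IH; set P := \sum_(0 <= k < n.+1) _; set Q := \sum_(0 <= k < n.+2) _.
move: (pochhammer (1 + c) n) (pochhammer (1 + A - B) n) (pochhammer (1 + A) n)
  (pochhammer (1 + c - B) n).
move=> a1 a2 a3 a4 IH e.
transitivity (a1 * a2 * ((1 + c + n%:R) * (1 + A - B + n%:R) * Q)); first by ring.
by rewrite e; transitivity (P * (a1 * a2) * ((1 + A + n%:R) * (1 + c - B + n%:R)));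
  [ring | rewrite IH; ring].
Qed.
End Dixon.

(** * The perturbed Dixon sum with base parameter [- 2 m] *)

Section EvenDixon.
Variables (F : numFieldType) (y : F).
Hypothesis ny : forall i : nat, i%:R ^+ 2 - y != 0.

(** With [y = v ^ 2] this is [(-a+v)_k (-a-v)_k / ((1+v)_k (1-v)_k)]; no square root of [y] has to
    exist. *)
Definition even_weight a k : F :=
  \prod_(0 <= i < k) (((a%:R - i%:R) ^+ 2 - y) / (i.+1%:R ^+ 2 - y)).

Definition even_term a k : F := (-1) ^+ k * 'C(a, k)%:R * even_weight a k.

(** The polynomial part of the numerator of Zeilberger's rational certificate. *)
Let P m k : F :=
  - 116 + 46 * y - 2 * y ^+ 2 - 784 * m + 200 * m * y - 4 * m * y ^+ 2
  - 2084 * m ^+ 2 + 280 * m ^+ 2 * y - 2728 * m ^+ 3 + 128 * m ^+ 3 * y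
  - 1760 * m ^+ 4 - 448 * m ^+ 5
  + k * (207 - 39 * y + 1113 * m - 117 * m * y + 2214 * m ^+ 2
         - 84 * m ^+ 2 * y + 1932 * m ^+ 3 + 624 * m ^+ 4)
  + k ^+ 2 * (- 147 + 9 * y - 594 * m + 15 * m * y - 792 * m ^+ 2 - 348 * m ^+ 3)
  + k ^+ 3 * (48 + 132 * m + 90 * m ^+ 2) + k ^+ 4 * (- 6 - 9 * m).

Let G m k : F :=
  if k is j.+1 then
    - 2%:R^-1 * (-1) ^+ j * 'C(m.*2.+1, j)%:R * even_weight m.*2 j * P m%:R j.+1%:R
    / (m.*2.+1%:R * ((m.*2.+1%:R - j%:R) ^+ 2 - y))
  else 0.

Lemma sqr_nat_neq a k : (a%:R - k%:R) ^+ 2 - y != 0.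
Proof.
case: (leqP k a) => h; first by rewrite -natrB // ny.
by rewrite -[a%:R - _]opprB sqrrN -natrB ?ny // ltnW.
Qed.

Lemma even_weightS a k : even_weight a k.+1 =
  even_weight a k * (((a%:R - k%:R) ^+ 2 - y) / (k.+1%:R ^+ 2 - y)).
Proof. by rewrite /even_weight big_nat_recr. Qed.

(** Passing from [a] to [a+1] moves the numerator factors by one place, so only the two end factors
    differ. *)
Lemma even_weight_shift a k : even_weight a.+1 k * ((a.+1%:R - k%:R) ^+ 2 - y) =
  even_weight a k * (a.+1%:R ^+ 2 - y).
Proof.
elim: k => [|k IH]; first by rewrite /even_weight !big_nil subr0.
have h1 := ny k.+1; have h2 := sqr_nat_neq a.+1 k.
rewrite !even_weightS (canRL (mulfK h2) IH).
by move: h1 h2; rewrite -!natr1 => h1 h2; field; rewrite h1 h2.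
Qed.

Lemma natr_bin_down n k :
  (n%:R - k%:R) * 'C(n, k)%:R = n%:R * 'C(n.-1, k)%:R :> F.
Proof.
case: (leqP k n) => h; first by rewrite -natrB // -!natrM mul_bin_down.
by rewrite !bin_small ?mulr0 // (leq_ltn_trans (leq_pred n)).
Qed.

(* Zeilberger's recurrence for [even_term], divided by the term itself *)
Lemma even_certificate_poly m k :
  ((m + 1) ^+ 2 - y) * ((2 * m + 2) ^+ 2 - y) * ((2 * m + 1) ^+ 2 - y)
    * (2 * m + 2) * (2 * m + 1)
  + 3 * (3 * m + 1) * (3 * m + 2) * (2 * m + 1 - k) * (2 * m + 2 - k)
    * ((2 * m + 1 - k) ^+ 2 - y) * ((2 * m + 2 - k) ^+ 2 - y)
  = - 2^-1 * ((2 * m + 2 - k) * ((2 * m + 2 - k) ^+ 2 - y) * P m (k + 1)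
              + k * (k ^+ 2 - y) * P m k).
Proof.
apply: (mulfI (_ : 2 != 0)); first by rewrite pnatr_eq0.
rewrite mulrA mulrN divff ?pnatr_eq0 // /P; ring.
Qed.

Lemma even_certificate m k :
  ((m.+1%:R ^+ 2 - y) * even_term m.*2.+2 k
   + 3%:R * (3 * m + 1)%:R * (3 * m + 2)%:R * even_term m.*2 k)
  = G m k.+1 - G m k.
Proof.
rewrite /even_term /G.
have am : m.*2%:R = 2 * m%:R :> F by rewrite -muln2 natrM mulrC.
move: am; set a := m.*2 => am.
have s1 := sqr_nat_neq a.+1 k; have s2 := sqr_nat_neq a.+2 k.
have w1 := even_weight_shift a k; have w2 := even_weight_shift a.+1 k.
have b1 := natr_bin_down a.+2 k; have b2 := natr_bin_down a.+1 k.
have a1 : a.+1%:R != 0 :> F by rewrite pnatr_eq0.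
have a2 : a.+2%:R != 0 :> F by rewrite pnatr_eq0.
move/(canLR (mulKf a2))/esym: b1 => b1.
move/(canLR (mulKf a1))/esym: b2; rewrite /= in b1 *; rewrite b1 => b2.
move/(canRL (mulfK s1)): w1 => w1; move/(canRL (mulfK s2)): w2; rewrite w1 => w2.
have H := even_certificate_poly m%:R k%:R.
have E1 : m.+1%:R = m%:R + 1 :> F by rewrite -natr1.
have E2 : a.+2%:R = 2 * m%:R + 2 :> F by rewrite -!natr1 am; ring.
have E3 : a.+1%:R = 2 * m%:R + 1 :> F by rewrite -!natr1 am; ring.
have E4 : (3 * m + 1)%:R = 3 * m%:R + 1 :> F by rewrite natrD natrM.
have E5 : (3 * m + 2)%:R = 3 * m%:R + 2 :> F by rewrite natrD natrM.
rewrite -E1 -E2 -E3 -E4 -E5 (natr1 k) in H.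
apply/eqP; rewrite -subr_eq0; apply/eqP; move/eqP: H; rewrite -subr_eq0 => /eqP.
case: k => [|k] in s1 s2 w1 w2 b1 b2 *.
  rewrite w2 !bin0 /even_weight big_nil expr0.
  move: s1 s2 (P _ 0%:R) (P _ 1%:R) a1 a2; rewrite !subr0.
  move: (a.+1%:R) (a.+2%:R) (m.+1%:R ^+ 2) (_ * _ * (3 * m + 2)%:R).
  move=> c1 c2 c3 c4 h1 h2 P0 P1 h3 h4 H.
  set d := (c2 * c1 * (c1 ^+ 2 - y) * (c2 ^+ 2 - y))^-1.
  apply: (etrans _ (etrans (congr1 ( *%R^~ d) H) (mul0r d))); rewrite /d /=.
  by field; rewrite h1 h2 h3 h4.
have b3 : 'C(a.+1, k)%:R = k.+1%:R * 'C(a.+2, k.+1)%:R / a.+2%:R :> F.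
  by rewrite -natrM -mul_bin_diag natrM mulrC mulKf.
have k0 := ny k.+1.
have s3 : (a.+1%:R - k%:R) ^+ 2 - y = (a.+2%:R - k.+1%:R) ^+ 2 - y.
  by rewrite -!natr1; ring.
have s4 : (a%:R - k%:R) ^+ 2 - y = (a.+1%:R - k.+1%:R) ^+ 2 - y.
  by rewrite -!natr1; ring.
rewrite w2 b2 ?b1 b3 s3 even_weightS s4 (exprS _ k).
move: (even_weight a k) ('C(a.+2, k.+1)%:R : F) ((-1) ^+ k : F) => w b e.
move: s1 s2 k0 (P _ k.+1%:R) (P _ k.+2%:R).
move: ((a.+1%:R - k.+1%:R) ^+ 2 - y) ((a.+2%:R - k.+1%:R) ^+ 2 - y)
  (k.+1%:R ^+ 2 - y) (m.+1%:R ^+ 2 - y) (a.+1%:R ^+ 2 - y) (a.+2%:R ^+ 2 - y).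
move: (_ * _ * (3 * m + 2)%:R) (a.+1%:R) (a.+2%:R) a1 a2 (k.+1%:R).
move=> c4 c1 c2 h1 h2 x S1 S2 K0 K1 Y1 Y2 h3 h4 h5 P0 P1 H.
(* [d] is the hypergeometric factor by which the recurrence was divided to reach the polynomial
   identity [H]. *)
set d := - e * b * w / (c2 * c1 * K0 * S2).
apply: (etrans _ (etrans (congr1 ( *%R^~ d) H) (mul0r d))); rewrite /d /=.
by field; rewrite h1 h2 h3 h4 h5.
Qed.

(** Here the series terminates through its base parameter, a case outside [dixon_sum]; the
    telescoped certificate gives the recurrence in [m]. At [y = 0] this would be Dixon's identity
    for alternating sums of cubes of binomial coefficients. *)
Lemma even_dixon_sum m :
  (\prod_(0 <= j < m) (j.+1%:R ^+ 2 - y)) * (\sum_(0 <= k < m.*2.+1) even_term m.*2 k)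
    * m`!%:R
  = (-1) ^+ m * (3 * m)`!%:R.
Proof.
elim: m => [|m IH].
  by rewrite big_nil big_nat1 /even_term /even_weight big_nil !mulr1.
have : \sum_(0 <= k < m.*2.+3) ((m.+1%:R ^+ 2 - y) * even_term m.*2.+2 k
   + 3%:R * (3 * m + 1)%:R * (3 * m + 2)%:R * even_term m.*2 k) = 0.
  rewrite (eq_bigr _ (fun k _ => even_certificate m k)) telescope_sumr //.
  by rewrite /G bin_small // mulr0 !mul0r subr0.
rewrite big_split -!mulr_sumr /= => /eqP; rewrite addr_eq0.
rewrite [X in _ == - (_ * X)]big_nat_recr // [X in _ == - (_ * (X + _))]big_nat_recr //=.
rewrite /even_term !(@bin_small m.*2) // !mulr0 !mul0r !addr0 -/even_term => /eqP e.
rewrite big_nat_recr //= doubleS factS natrM.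
transitivity ((\prod_(0 <= j < m) (j.+1%:R ^+ 2 - y)) * m`!%:R * m.+1%:R *
  ((m.+1%:R ^+ 2 - y) * (\sum_(0 <= k < m.*2.+3) even_term m.*2.+2 k))).
  by ring.
rewrite e mulnS !factS !natrM exprS.
transitivity (- (3%:R * m.+1%:R) * (3 * m + 1)%:R * (3 * m + 2)%:R *
  ((\prod_(0 <= j < m) (j.+1%:R ^+ 2 - y)) * (\sum_(0 <= k < m.*2.+1) even_term m.*2 k)
   * m`!%:R)); first by ring.
rewrite IH -natrM (_ : 3 * m.+1 = (3 * m).+3)%N ?addn1 ?addn2; [ring | lia].
Qed.
End EvenDixon.

(** * Products and harmonic sums prime to p *)

(** The factor [e] encodes a congruence. When [p ^ 4 = 0], [e = p ^ 2] gives an expansion modulo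
    [p ^ 2] for [d] divisible by [p], and [e = 1] an exact one for [d] divisible by [p ^ 2]. *)
Lemma prod_first_order (R : comUnitRingType) (e d : R) (b c : nat -> R) n :
    e * d ^+ 2 = 0 -> (forall i, (i < n)%N -> c i \is a GRing.unit) ->
  e * \prod_(0 <= i < n) (c i + d * b i)
  = e * \prod_(0 <= i < n) c i * (1 + d * \sum_(0 <= i < n) b i / c i).
Proof.
move=> ed; elim: n => [|n IH] uc; first by rewrite !big_nil mulr0 addr0 !mulr1.
rewrite !big_nat_recr //= mulrA IH => [|i lin]; last exact/uc/ltnW.
have un := uc n (leqnn _).
move: (\prod_(0 <= i < n) c i) (\sum_(0 <= i < n) _) => P S.
transitivity (e * P * (1 + d * S) * (c n + d * (c n * (b n / c n)))).
  by rewrite (mulrCA (c n)) divrr // mulr1.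
move: (b n / c n) => q.
apply/eqP; rewrite -subr_eq0.
rewrite (_ : _ - _ = e * d ^+ 2 * (P * S * c n * q)); last by ring.
by rewrite ed mul0r.
Qed.

Lemma inv_first_order (R : comUnitRingType) (e c d : R) :
    e * d ^+ 2 = 0 -> c \is a GRing.unit -> c + d \is a GRing.unit ->
  e * (c + d)^-1 = e * (c^-1 - d / c ^+ 2).
Proof.
move=> ed uc ucd; apply: (mulrI ucd).
rewrite mulrCA divrr // mulr1 mulrCA.
have cc : c * c^-1 = 1 by rewrite divrr.
rewrite -exprVn; move: cc; move: (c^-1) => v cc.
have -> : (c + d) * (v - d * v ^+ 2) = c * v * (1 - d * v) + d * v - d ^+ 2 * v ^+ 2.
  by ring.
by rewrite cc mul1r subrK mulrBr mulrA ed mul0r subr0 mulr1.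
Qed.

Lemma dvdz_small_nat (p : nat) (z : int) :
  z != 0 -> (`|z| < p)%N -> ~~ (p %| z)%Z.
Proof.
move=> z0 zp; rewrite dvdzE /=; apply/negP => /dvdn_leq; rewrite absz_gt0 => /(_ z0).
by rewrite leqNgt zp.
Qed.

Lemma int_const (T : Type) (f : int -> T) :
  (forall z, f (z + 1) = f z) -> forall z, f z = f 0.
Proof.
move=> h; case=> n; first by elim: n => // n <-; rewrite -(h n) -addn1 PoszD.
elim: n => [|n IH]; first exact/esym/(h (-1)).
by rewrite -IH -(h (Negz n.+1)); congr f; lia.
Qed.

Lemma big_nat_double (R : nmodType) (f : nat -> R) n :
  \sum_(0 <= i < n.*2) f i = \sum_(0 <= i < n) f i.*2 + \sum_(0 <= i < n) f i.*2.+1.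
Proof.
elim: n => [|n IH]; first by rewrite !big_nil addr0.
by rewrite doubleS !big_nat_recr //= IH addrACA addrA.
Qed.

Section Periodic.
Variables (V : zmodType) (p : nat) (f : int -> V).
Hypothesis fp : forall z, f (z + p%:Z) = f z.

Lemma periodic_sum z : \sum_(0 <= i < p) f (z + i%:Z) = \sum_(0 <= i < p) f i%:Z.
Proof.
rewrite (int_const (f := fun z => \sum_(0 <= i < p) f (z + i%:Z))); last first.
  move=> {}z; apply: (addrI (f z)).
  transitivity (\sum_(0 <= i < p.+1) f (z + i%:Z)).
    rewrite big_nat_recl // addr0; congr (_ + _).
    by apply: eq_bigr => i _; congr f; lia.
  by rewrite big_nat_recr //= fp addrC.
by apply: eq_bigr => i _; rewrite add0r.
Qed.

Lemma periodicM z j : f (z + p%:Z * j) = f z.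
Proof.
rewrite (int_const (f := fun j => f (z + p%:Z * j))) ?mulr0 ?addr0 // => i.
by rewrite mulrDr mulr1 addrA fp.
Qed.

End Periodic.

(** Both sides are the sum over [2 p] consecutive integers. As [p] is odd,
    [f (2 i + 1) = f (2 (i + (p + 1) / 2))], so the odd arguments contribute as much as the even
    ones. The factor two is removed later, where 2 is invertible. *)
Lemma periodic_sum_double (V : zmodType) (p : nat) (f : int -> V) :
    odd p -> (forall z, f (z + p%:Z) = f z) ->
  (\sum_(0 <= i < p) f (2 * i%:Z)) *+ 2 = (\sum_(0 <= i < p) f i%:Z) *+ 2.
Proof.
move=> odd_p fp.
have gp c z : f (2 * (z + p%:Z) + c) = f (2 * z + c).
  by rewrite -(fp (2 * z + c)) -(fp (2 * z + c + _)); congr f; lia.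
transitivity (\sum_(0 <= i < p.*2) f i%:Z).
  rewrite big_nat_double mulr2n; congr (_ + _).
    by apply: eq_bigr => i _; congr f; lia.
  rewrite -(periodic_sum (f := fun z => f (2 * z)) _ (p./2.+1)%:Z) => [|z].
    apply: eq_bigr => i _; rewrite -[RHS]fp; congr f.
    by have := odd_double_half p; rewrite odd_p add1n; lia.
  by have := gp 0 z; rewrite !addr0.
rewrite -addnn (big_cat_nat (leq0n p) (leq_addr p p)) /= mulr2n; congr (_ + _).
rewrite -{1}[p]add0n big_addn addnK; apply: eq_bigr => i _.
by rewrite PoszD fp.
Qed.

Section Coprime.
Variables (p : nat) (R : comUnitRingType).
Hypothesis unitZ : forall z : int, ~~ (p %| z)%Z -> (z%:~R : R) \is a GRing.unit.

(** Multiples of [p] get the neutral value, [1] in products and [0] in sums. Arguments are integers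
    because the ranges may start below zero. *)
Definition coprime_factor (z : int) : int := if (p %| z)%Z then 1 else z.
Definition coprime_inv (z : int) : R := if (p %| z)%Z then 0 else z%:~R^-1.
Definition coprime_poch (z : int) n : int :=
  \prod_(0 <= i < n) coprime_factor (z + i%:Z).
Definition coprime_harm (z : int) n : R :=
  \sum_(0 <= i < n) coprime_inv (z + i%:Z).

Local Notation mu := coprime_factor.
Local Notation nu := coprime_inv.
Local Notation M := coprime_poch.
Local Notation N := coprime_harm.

Lemma coprime_factor_unit z : ((mu z)%:~R : R) \is a GRing.unit.
Proof. by rewrite /mu; case: ifP => [_|/negbT/unitZ //]; exact: unitr1. Qed.

Lemma coprime_poch_unit z n : ((M z n)%:~R : R) \is a GRing.unit.
Proof.
rewrite /M rmorph_prod; apply: (big_ind (fun x : R => x \is a GRing.unit)) => //.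
- exact: unitr1.
- by move=> a b ua ub; rewrite unitrM ua.
- by move=> i _; apply: coprime_factor_unit.
Qed.

Lemma coprime_pochD z m n : M z (m + n) = M z m * M (z + m%:Z) n.
Proof.
rewrite /M (big_cat_nat (leq0n m) (leq_addr n m)) /=; congr (_ * _).
rewrite -{1}[m]add0n big_addn addnC addnK; apply: eq_bigr => i _.
by rewrite PoszD addrA addrAC.
Qed.

Lemma coprime_harmD z m n : N z (m + n) = N z m + N (z + m%:Z) n.
Proof.
rewrite /N (big_cat_nat (leq0n m) (leq_addr n m)) /=; congr (_ + _).
rewrite -{1}[m]add0n big_addn addnC addnK; apply: eq_bigr => i _.
by rewrite PoszD addrA addrAC.
Qed.

Lemma dvdz_shift (z d : int) : (p %| d)%Z -> (p %| z + d)%Z = (p %| z)%Z.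
Proof. by move=> pd; rewrite rpredDr. Qed.

Lemma coprime_inv_shift (e : R) (z d : int) :
    (p %| d)%Z -> e * d%:~R ^+ 2 = 0 ->
  e * nu (z + d) = e * (nu z - d%:~R * nu z ^+ 2).
Proof.
move=> pd ed; rewrite /nu dvdz_shift //; case: ifP => [_|/negbT uz].
  by rewrite expr0n [_%:~R * _]mulr0 subr0.
rewrite exprVn rmorphD inv_first_order //; first exact: unitZ.
by rewrite -rmorphD; apply: unitZ; rewrite dvdz_shift.
Qed.

Lemma coprime_harm_shift (e : R) (z d : int) n :
    (p %| d)%Z -> e * d%:~R ^+ 2 = 0 ->
  e * N (z + d) n = e * (N z n - d%:~R * \sum_(0 <= i < n) nu (z + i%:Z) ^+ 2).
Proof.
move=> pd ed; rewrite mulr_sumr mulr_sumr -sumrB mulr_sumr.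
by apply: eq_bigr => i _; rewrite addrAC coprime_inv_shift.
Qed.

(** A shift by a multiple of [p] omits the same factors, so [coprime_harm] is the logarithmic
    derivative of [coprime_poch] for such shifts. *)
Lemma coprime_poch_shift (e : R) (z d : int) n :
    (p %| d)%Z -> e * d%:~R ^+ 2 = 0 ->
  e * (M (z + d) n)%:~R = e * (M z n)%:~R * (1 + d%:~R * N z n).
Proof.
move=> pd ed; rewrite /M !rmorph_prod /=.
pose b i : R := if (p %| z + i%:Z)%Z then 0 else 1.
have -> : N z n = \sum_(0 <= i < n) b i / (mu (z + i%:Z))%:~R.
  by apply: eq_bigr => i _; rewrite /nu /b /mu; case: ifP; rewrite ?mul0r ?mul1r.
rewrite -prod_first_order // => [|i _]; last exact: coprime_factor_unit.
congr (_ * _); apply: eq_bigr => i _.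
rewrite /mu /b (addrAC z d) (dvdz_shift (z + i%:Z) pd).
case: (p %| z + i%:Z)%Z; first by rewrite mulr0 addr0.
by rewrite mulr1 rmorphD.
Qed.

Lemma pochhammer_coprime (z : int) n :
  (forall i, (i < n)%N -> ~~ (p %| z + i%:Z)%Z) -> pochhammer z n = M z n.
Proof.
move=> h; rewrite /pochhammer /M !big_nat; apply: eq_bigr => i /andP[_ lin].
by rewrite /mu (negbTE (h i lin)) natz.
Qed.

(** Among at most [p] consecutive integers no second one is divisible by [p], so [coprime_poch]
    omits exactly the factor displayed. *)
Lemma pochhammer_one_dvd (z : int) n j :
    (n <= p)%N -> (j < n)%N -> (p %| z + j%:Z)%Z ->
  pochhammer z n = (z + j%:Z) * M z n.
Proof.
move=> np jn pj; rewrite /pochhammer /M !big_mkord.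
rewrite (bigD1 (Ordinal jn)) //= [in RHS](bigD1 (Ordinal jn)) //=.
have -> : mu (z + j%:Z) = 1 by rewrite /mu pj.
rewrite mul1r !natz; congr (_ * _); apply: eq_bigr => i ij.
rewrite /mu natz ifN //.
have -> : z + i%:Z = (z + j%:Z) + (i%:Z - j%:Z) by lia.
rewrite rpredDl //; apply: dvdz_small_nat.
  by apply: contraNneq ij => e; apply/eqP/val_inj => /=; lia.
by have := ltn_ord i; lia.
Qed.

Lemma coprime_inv_mul2 z : prime p -> (2 < p)%N -> nu (2 * z) = 2^-1 * nu z.
Proof.
move=> pp p2; have u2 : (2 : R) \is a GRing.unit.
  by apply: (unitZ (z := 2)); exact: dvdz_small_nat.
rewrite /nu Gauss_dvdzr; last by rewrite coprimezE /= prime_coprime // gtnNdvd.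
case: ifP => [_|/negbT uz]; first by rewrite mulr0.
by rewrite rmorphM /= invrM // ?unitZ // mulrC.
Qed.

Lemma coprime_invN z : nu (- z) = - nu z.
Proof. by rewrite /nu rpredN; case: ifP; rewrite ?oppr0 // rmorphN invrN. Qed.

Lemma coprime_inv_dvd z : (p %| z)%Z -> nu z = 0.
Proof. by rewrite /nu => ->. Qed.

End Coprime.

(** * Full periods: congruences modulo [p ^ k] as equalities multiplied by [p ^ (4 - k)] *)

Section ModP4.
Variables (p : nat) (R : comUnitRingType).
Hypothesis pr_p : prime p.
Hypothesis p_gt3 : (3 < p)%N.
Hypothesis unitZ : forall z : int, ~~ (p %| z)%Z -> (z%:~R : R) \is a GRing.unit.
Hypothesis p4 : (p%:R : R) ^+ 4 = 0.

Local Notation mu := (coprime_factor p).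
Local Notation nu := (coprime_inv p R).
Local Notation M := (coprime_poch p).
Local Notation N := (coprime_harm p R).
Local Notation P := (p%:R : R).

Lemma odd_p : odd p.
Proof. by case: (even_prime pr_p) p_gt3 => [->|]. Qed.

Lemma unit2 : (2 : R) \is a GRing.unit.
Proof. by apply: (unitZ (z := 2)); apply: dvdz_small_nat => //=; exact: ltnW. Qed.

Lemma unit3 : (3 : R) \is a GRing.unit.
Proof. by apply: (unitZ (z := 3)); apply: dvdz_small_nat. Qed.

Lemma double_cancel0 (u : R) : u *+ 2 = 0 -> u = 0.
Proof. by move=> e; apply: (mulrI unit2); rewrite mulr0 mulr_natl. Qed.

Lemma double_cancel (u v : R) : u *+ 2 = v *+ 2 -> u = v.
Proof.
by move=> e; apply/eqP; rewrite -subr_eq0; apply/eqP/double_cancel0; rewrite mulrnBl e subrr.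
Qed.

Lemma intr_p (w : int) : (p%:Z * w)%:~R = P * w%:~R :> R.
Proof. by rewrite rmorphM. Qed.

Lemma pp_shift w : P ^+ 2 * (p%:Z * w)%:~R ^+ 2 = 0.
Proof. by rewrite intr_p exprMn mulrA -exprD p4 mul0r. Qed.

Lemma dvd_pM w : (p %| p%:Z * w)%Z. Proof. exact: dvdz_mulr. Qed.

Lemma inv_mod_p z w : P ^+ 3 * nu (z + p%:Z * w) = P ^+ 3 * nu z.
Proof.
rewrite (coprime_inv_shift unitZ) ?dvd_pM //; last first.
  by rewrite exprS -mulrA pp_shift mulr0.
by rewrite mulrBr intr_p !mulrA -exprSr p4 !mul0r subr0.
Qed.

Lemma inv_mod_p1 z : P ^+ 3 * nu (z + p%:Z) = P ^+ 3 * nu z.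
Proof. by rewrite -[p%:Z]mulr1 inv_mod_p. Qed.

(** Doubling permutes the residues and divides each inverse square by four, so [S = S / 4] and
    [3 S = 0], where 3 is invertible because [p > 3]. *)
Lemma sum_inv_sqr z : P ^+ 3 * (\sum_(0 <= i < p) nu (z + i%:Z) ^+ 2) = 0.
Proof.
pose f z := P ^+ 3 * nu z ^+ 2.
have fp y : f (y + p%:Z) = f y.
  by rewrite /f !expr2 !mulrA inv_mod_p1 mulrAC inv_mod_p1.
rewrite mulr_sumr (periodic_sum fp).
have := double_cancel (periodic_sum_double odd_p fp).
rewrite (eq_bigr (fun i => 2^-1 ^+ 2 * f i%:Z)) => [|i _]; last first.
  by rewrite /f (coprime_inv_mul2 unitZ _ pr_p (ltnW p_gt3)) exprMn mulrCA.
rewrite -mulr_sumr => e; apply: (mulrI unit3); rewrite mulr0.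
move: e; set S := bigop _ _ _ => e.
have : 2 ^+ 2 * S - 2 ^+ 2 * (2^-1 ^+ 2 * S) = 0 by rewrite e subrr.
rewrite mulrA -exprMn divrr ?unit2 // expr1n => h.
by rewrite -[RHS]h; ring.
Qed.

Lemma sum_inv_mod_p z : P ^+ 3 * N z p = 0.
Proof.
pose f z := P ^+ 3 * nu z.
rewrite mulr_sumr (periodic_sum (f := f) inv_mod_p1).
have := double_cancel (periodic_sum_double odd_p (f := f) inv_mod_p1).
rewrite (eq_bigr (fun i => 2^-1 * f i%:Z)) => [|i _]; last first.
  by rewrite /f (coprime_inv_mul2 unitZ _ pr_p (ltnW p_gt3)) mulrCA.
rewrite -mulr_sumr; set S := bigop _ _ _ => e.
have : 2 * S - 2 * (2^-1 * S) = 0 by rewrite e subrr.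
by rewrite mulrA divrr ?unit2 // => h; rewrite -[RHS]h; ring.
Qed.

(** The first-order change is [p j] times a full sum of inverse squares, which is zero modulo
    [p]. *)
Lemma harm_period z j : P ^+ 2 * N (z + p%:Z * j) p = P ^+ 2 * N z p.
Proof.
rewrite (coprime_harm_shift unitZ) ?dvd_pM ?pp_shift // mulrBr.
rewrite intr_p (_ : P ^+ 2 * (_ * _) =
  P ^+ 3 * (\sum_(0 <= i < p) nu (z + i%:Z) ^+ 2) * j%:~R); last by ring.
by rewrite sum_inv_sqr mul0r subr0.
Qed.

Lemma harm_blocks z t : P ^+ 2 * N z (p * t) = t%:R * (P ^+ 2 * N z p).
Proof.
elim: t => [|t IH]; first by rewrite muln0 /coprime_harm big_nil mulr0 mul0r.
rewrite mulnSr coprime_harmD mulrDr IH PoszM harm_period.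
by rewrite -[t.+1%:R]natr1 mulrDl mul1r.
Qed.

Lemma poch_period z j : P ^+ 2 * (M (z + p%:Z * j) p)%:~R = P ^+ 2 * (M z p)%:~R.
Proof.
rewrite (coprime_poch_shift unitZ) ?dvd_pM ?pp_shift // intr_p.
rewrite mulrDr mulr1 -[RHS]addr0; congr (_ + _).
rewrite (_ : _ * _ = (P ^+ 3 * N z p) * ((M z p)%:~R * j%:~R)); last by ring.
by rewrite sum_inv_mod_p mul0r.
Qed.

Lemma poch_blocks z t : P ^+ 2 * (M z (p * t))%:~R = P ^+ 2 * (M z p)%:~R ^+ t.
Proof.
elim: t => [|t IH]; first by rewrite muln0 /coprime_poch big_nil.
rewrite mulnSr coprime_pochD rmorphM /= mulrCA PoszM poch_period.
by rewrite mulrCA mulrA IH [_ ^+ t.+1]exprSr mulrA.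
Qed.

(* Wolstenholme's theorem *)
Lemma wolstenholme j : P ^+ 2 * N (p%:Z * j) p = 0.
Proof.
rewrite -[_ * j]add0r harm_period; apply: double_cancel0; rewrite mulr2n.
(* The windows [[-p, -1]] and [[1-p, 0]] differ by multiples of [p] only, and [z -> - z] sends the
   second to [[0, p-1]]. Since the sum is also invariant under a shift by [p], it equals its
   opposite. *)
have e : N (- p%:Z) p = - N 0 p.
  have -> : N (- p%:Z) p = N (1 - p%:Z) p.
    apply: (@addrI _ (nu (- p%:Z + p%:Z))); rewrite addNr coprime_inv_dvd // !add0r.
    have := coprime_harmD p R (- p%:Z) 1 p; rewrite add1n.
    rewrite /coprime_harm big_nat1 addr0 big_nat_recr //= addNr.
    by rewrite !coprime_inv_dvd ?rpredN // addr0 add0r (addrC (- _)).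
  rewrite /coprime_harm big_nat_rev /= -sumrN; apply: eq_big_nat => i /andP[_ ip].
  by rewrite -coprime_invN; congr nu; lia.
rewrite -{1}(harm_period 0 (-1)) add0r mulrN1 e mulrN addNr //.
Qed.

End ModP4.

(** * Quotients of values of the Gamma function and their logarithmic derivatives *)

Lemma mul_expr_eq (R : comPzRingType) (e u v : R) n :
  e * u = e * v -> e * u ^+ n = e * v ^+ n.
Proof.
move=> h; elim: n => [|n IH]; first by rewrite !expr0.
by rewrite !exprS mulrA h -mulrA mulrCA IH mulrCA.
Qed.

Section GammaHarmonic.
Variables (p : nat) (R : comUnitRingType).
Hypothesis pr_p : prime p.
Hypothesis p_gt3 : (3 < p)%N.
Hypothesis unitZ : forall z : int, ~~ (p %| z)%Z -> (z%:~R : R) \is a GRing.unit.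
Hypothesis p4 : (p%:R : R) ^+ 4 = 0.
(** [G] stands for [Gamma_p] at integers and [H] for the harmonic sum at the residue modulo [p ^ 2].
    They enter through their functional equations, that of [H] holding modulo [p ^ 2]. *)
Variables G H : int -> R.
Local Notation mu := (coprime_factor p).
Local Notation nu := (coprime_inv p R).
Local Notation M := (coprime_poch p).
Local Notation N := (coprime_harm p R).
Local Notation x := ((p%:R : R) ^+ 2).

Section Gamma.
Hypothesis G0 : G 0 = 1.
Hypothesis GS : forall z, G (z + 1) = - (mu z)%:~R * G z.

Lemma gammaD z n : G (z + n%:Z) = (-1) ^+ n * (M z n)%:~R * G z.
Proof.
elim: n => [|n IH].
  by rewrite /coprime_poch big_nil addr0 !mul1r.
rewrite -addn1 PoszD addrA GS IH coprime_pochD /coprime_poch big_nat1 addr0.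
by rewrite rmorphM addn1 exprS /=; ring.
Qed.

(** The quotients [G (y + p t) / G y] and [G y / G (y - p t)] are, with the same sign, products of
    [t] blocks of length [p], and modulo [p ^ 2] a block does not change under a shift by a multiple
    of [p]. *)
Lemma gamma_sym y t :
  x * (G (y + p%:Z * t%:Z) * G (y - p%:Z * t%:Z)) = x * G y ^+ 2.
Proof.
rewrite -PoszM gammaD; set w := y - _.
have e : G y = (-1) ^+ (p * t) * (M w (p * t))%:~R * G w.
  by rewrite -gammaD /w subrK.
have b : x * (M w (p * t))%:~R = x * (M y (p * t))%:~R.
  rewrite !(poch_blocks pr_p p_gt3 unitZ p4); apply: mul_expr_eq.
  rewrite -[RHS](poch_period pr_p p_gt3 unitZ p4 y (- t%:Z)).
  by rewrite mulrN -PoszM.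
transitivity (x * (M y (p * t))%:~R * ((-1) ^+ (p * t) * G y * G w)); first by ring.
rewrite -b; transitivity (x * G y * ((-1) ^+ (p * t) * (M w (p * t))%:~R * G w)).
  by ring.
by rewrite -e; ring.
Qed.

Variables (delta t a : nat).
Hypothesis dt : (2 * delta + a = p * t)%N.
Local Notation d := (delta%:Z).

(** Each product is, up to sign, a quotient of two values of [G]. The relation [2 delta + a = p t]
    puts the four extra values at [1 + p t], [1 - p t], [1 - delta + p t] and [1 - delta - p t],
    where [gamma_sym] pairs them. *)
Lemma gamma_quotient :
  x * ((M (1 + 2 * d) a)%:~R * (M (1 - 3 * d - a%:Z) a)%:~R)
    * (G (1 + 2 * d) * G (1 - 2 * d) * G (1 - d) ^+ 2)
  = x * ((M (1 + d) a)%:~R * (M (1 - 2 * d - a%:Z) a)%:~R)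
    * (G (1 + d) * G (1 - 3 * d)).
Proof.
have e1 := gammaD (1 + 2 * d) a.
have e2 := gammaD (1 - 3 * d - a%:Z) a.
have e3 := gammaD (1 + d) a.
have e4 := gammaD (1 - 2 * d - a%:Z) a.
have z1 : 1 + 2 * d + a%:Z = 1 + p%:Z * t%:Z by lia.
have z2 : 1 - 3 * d - a%:Z = (1 - d) - p%:Z * t%:Z by lia.
have z3 : 1 + d + a%:Z = (1 - d) + p%:Z * t%:Z by lia.
have z4 : 1 - 2 * d - a%:Z = 1 - p%:Z * t%:Z by lia.
rewrite subrK in e2; rewrite subrK in e4; rewrite z1 in e1; rewrite z3 in e3.
have G1 : G 1 ^+ 2 = 1.
  by rewrite -[1]add0r GS G0 mulr1 /coprime_factor dvdz0 sqrrN expr1n.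
have s1 := gamma_sym 1 t; have s2 := gamma_sym (1 - d) t.
move: e1 e2 e3 e4 s1 s2; rewrite z2 z4 G1.
set M1 := (M (1 + 2 * d) a)%:~R; set M2 := (M _ a)%:~R; set M3 := (M (1 + d) a)%:~R.
set M4 := (M _ a)%:~R; move: ((-1) ^+ a) => s e1 e2 e3 e4 s1 s2.
transitivity (x * (G (1 + p%:Z * t%:Z) * G (1 - p%:Z * t%:Z)) * M2 * M4 * G (1 - d) ^+ 2).
  by rewrite e1 e4; ring.
rewrite s1; transitivity (x * G (1 - d) ^+ 2 * M2 * M4); first by ring.
by rewrite -s2 e2 e3; ring.
Qed.

End Gamma.

Section Harmonic.
Hypothesis H0 : x * H 0 = 0.
Hypothesis HS : forall z, x * H (z + 1) = x * (H z + nu (z + 1)).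

Lemma harmD z n : x * H (z + n%:Z) = x * (H z + N (z + 1) n).
Proof.
elim: n => [|n IH]; first by rewrite /coprime_harm big_nil !addr0.
rewrite -(addn1 n) PoszD addrA HS mulrDr IH coprime_harmD /coprime_harm big_nat1 addr0.
by rewrite -mulrDr -addrA (addrAC z).
Qed.

(** [nu] is odd and zero at [0], so [H] has the same increments going right from [0] and left from
    [- 1]. *)
Lemma harm_refl n : x * H (- 1 - n%:Z) = x * H n%:Z.
Proof.
elim: n => [|n IH].
  by rewrite subr0; have := HS (-1); rewrite addNr coprime_inv_dvd // addr0 => <-.
have := HS (- 1 - n.+1%:Z).
have -> : - 1 - n.+1%:Z + 1 = - 1 - n%:Z by lia.
rewrite IH mulrDr => e; apply: (addIr (x * nu (- 1 - n%:Z))); rewrite -e.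
have -> : n.+1%:Z = n%:Z + 1 by lia.
have -> : - 1 - n%:Z = - (n%:Z + 1) by lia.
by rewrite HS coprime_invN mulrDr -addrA -mulrDr addrN mulr0 addr0.
Qed.

Lemma harm_opp n : x * H n%:Z = x * (H (- n%:Z) + nu n%:Z).
Proof.
rewrite -harm_refl; have := HS (- 1 - n%:Z).
have -> : - 1 - n%:Z + 1 = - n%:Z by lia.
by rewrite coprime_invN !mulrDr => ->; rewrite mulrN subrK.
Qed.

Lemma harm_full : x * N 1 p = 0.
Proof.
have := wolstenholme pr_p p_gt3 unitZ p4 0; rewrite mulr0.
have := coprime_harmD p R 0 1 p; rewrite add1n /coprime_harm big_nat1 big_nat_recr //=.
by rewrite !add0r !coprime_inv_dvd // addr0 add0r => ->.
Qed.

Lemma harm_mul_p t : x * H (p%:Z * t%:Z) = 0.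
Proof.
rewrite -PoszM -[(p * t)%N%:Z]add0r harmD mulrDr H0 !add0r.
by rewrite (harm_blocks pr_p p_gt3 unitZ p4) harm_full mulr0.
Qed.

Lemma harm_mulN_p t : x * H (- (p%:Z * t%:Z)) = 0.
Proof.
rewrite -PoszM; have := harmD (- (p * t)%N%:Z) (p * t); rewrite addNr H0 mulrDr.
have -> : - (p * t)%N%:Z + 1 = 1 + p%:Z * (- t%:Z) by lia.
rewrite (harm_blocks pr_p p_gt3 unitZ p4) (harm_period pr_p p_gt3 unitZ p4).
by rewrite harm_full mulr0 addr0 => <-.
Qed.

Variables (delta t a : nat).
Hypothesis dt : (2 * delta + a = p * t)%N.
Local Notation d := (delta%:Z).
Local Notation beta := (N (1 - d) p).

(** The weights 2, 3, -1, -4 are the coefficients of [xi] in the four products of Dixon's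
    evaluation, negative for denominators. Each sum is a difference of values of [H]; [beta] is the
    increment of [H] over the block after [- d]. The reflection corrections from [H d] and [H (2 d)]
    cancel. *)
Lemma log_derivative :
  x * (2 * N (1 + 2 * d) a + 3 * N (1 - 3 * d - a%:Z) a - N (1 + d) a
       - 4 * N (1 - 2 * d - a%:Z) a)
  = x * (- 3 * (2 * H (- (2 * d)) + H (- d) - H (- (3 * d))) + 2 * t%:R * beta).
Proof.
have e1 := harmD (2 * d) a.
have e2 := harmD (- (3 * d) - a%:Z) a.
have e3 := harmD d a.
have e4 := harmD (- (2 * d) - a%:Z) a.
have e5 := harmD (- d) (p * t).
have e6 := harmD (- d - (p * t)%N%:Z) (p * t).
rewrite !subrK in e2 e4 e6.
have z1 : 2 * d + a%:Z = p%:Z * t%:Z by lia.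
have z2 : - (3 * d) - a%:Z = - d - (p * t)%N%:Z by lia.
have z3 : d + a%:Z = - d + (p * t)%N%:Z by lia.
have z4 : - (2 * d) - a%:Z = - (p%:Z * t%:Z) by lia.
have z5 : - d - (p * t)%N%:Z + 1 = 1 - d + p%:Z * (- t%:Z) by lia.
have z6 : - d + 1 = 1 - d by lia.
have z7 : 2 * d + 1 = 1 + 2 * d by lia.
have z8 : d + 1 = 1 + d by lia.
have z9 : 1 - 3 * d - a%:Z = - (3 * d) - a%:Z + 1 by lia.
have z10 : 1 - 2 * d - a%:Z = - (2 * d) - a%:Z + 1 by lia.
move: e1 e2 e3 e4 e5 e6; rewrite z9 z10 z7 z8 z1 z3 z5 z6 z2 z4 !mulrDr.
rewrite !(harm_blocks pr_p p_gt3 unitZ p4) (harm_period pr_p p_gt3 unitZ p4).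
rewrite harm_mul_p harm_mulN_p.
have r1 := harm_opp delta.
have r2 : x * H (2 * d) = x * (H (- (2 * d)) + 2^-1 * nu d).
  rewrite -(coprime_inv_mul2 unitZ _ pr_p (ltnW p_gt3)).
  exact: harm_opp (2 * delta)%N.
move: r1 r2; rewrite !mulrDr add0r.
move: (N _ a) (N _ a) (N _ a) (N _ a) => n4 n3 n2 n1.
move=> r1 r2 e1 e2 e3 e4 e5 e6.
have f1 : x * n1 = - (x * H (2 * d)) by apply/eqP; rewrite -addr_eq0 addrC -e1.
have f2 : x * n2 = x * H (- (3 * d)) - x * H (- d - (p * t)%N%:Z) by rewrite e2; ring.
have f3 : x * n3 = x * H (- d + (p * t)%N%:Z) - x * H d by rewrite e3; ring.
have f6 : x * H (- d - (p * t)%N%:Z) = x * H (- d) - t%:R * (x * beta).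
  by rewrite e6; ring.
rewrite -!mulrDr.
transitivity (2 * (x * n1) + 3 * (x * n2) - x * n3 - 4 * (x * n4)); first by ring.
have h2 : 2 * (x * (2^-1 * nu d)) = x * nu d.
  by rewrite mulrCA mulVKr // (unit2 p_gt3 unitZ).
rewrite f1 f2 f3 -e4 e5 f6 r1 r2.
transitivity (- 3 * (2 * (x * H (- (2 * d))) + x * H (- d) - x * H (- (3 * d)))
  + 2 * t%:R * (x * beta) + (x * nu d - 2 * (x * (2^-1 * nu d)))); first by ring.
by rewrite h2 subrr addr0; ring.
Qed.

Lemma beta_mod_p : x * (p%:R * beta) = 0.
Proof. by rewrite mulrA -exprSr sum_inv_mod_p. Qed.

(** Now [t] is even and [1 - d] is [1 + m] modulo [p]. Sliding the window from [[1, p]] by [m]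
    replaces the inverses of [1, ..., m] by those of [p + 1, ..., p + m], which changes them by [p]
    times inverse squares. *)
Lemma beta_even m : a = m.*2 ->
  x * beta = - (x * (p%:R * \sum_(0 <= i < m) nu i.+1%:Z ^+ 2)).
Proof.
move=> am; have even_t : ~~ odd t.
  have := congr1 odd dt; rewrite am oddD !oddM odd_double (odd_p pr_p p_gt3) /=.
  by move=> <-.
have te := odd_double_half t; rewrite (negbTE even_t) add0n in te.
have -> : 1 - d = 1 + m%:Z + p%:Z * (- t./2%:Z).
  have : (delta + m = p * t./2)%N by apply: double_inj; rewrite -muln2; lia.
  by lia.
rewrite (harm_period pr_p p_gt3 unitZ p4).
have e : N 1 m + N (1 + m%:Z) p = N 1 p + N (1 + p%:Z) m.
  by rewrite -!coprime_harmD addnC.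
have := congr1 (GRing.mul x) e; rewrite !mulrDr harm_full add0r.
have := @coprime_harm_shift p R unitZ x 1 (p%:Z * 1) m (dvd_pM p 1) (pp_shift p4 1).
rewrite mulr1 mulrBr => ->.
by move/addrI => ->; congr (- (_ * (_ * _))).
Qed.
End Harmonic.

End GammaHarmonic.

(** * First-order expansion of the Dixon sum *)

Section RatTransfer.
Variables (f g : nat -> int) (n : nat).
Let V := \prod_(0 <= k < n) g k.
Let W := \sum_(0 <= k < n) f k * \prod_(0 <= j < n | j != k) g j.

Lemma sum_common_denominator (S : comUnitRingType) :
    (forall k, (k < n)%N -> (g k)%:~R \is a @GRing.unit S) ->
  (\sum_(0 <= k < n) (f k)%:~R / (g k)%:~R) * V%:~R = W%:~R :> S.
Proof.
move=> ug; rewrite mulr_suml rmorph_sum; apply: eq_big_nat => k /andP[_ kn].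
rewrite rmorphM /V (bigD1_seq k) ?iota_uniq ?mem_index_iota //= rmorphM mulrA.
by rewrite mulrVK // ug.
Qed.

(** Clearing denominators gives the integer identity [W * X = Y * V], which can be read in any ring
    where [V] is invertible. *)
Lemma rat_sum_transfer (R : comUnitRingType) (X Y : int) :
    (forall k, (k < n)%N -> g k != 0) ->
    (forall k, (k < n)%N -> (g k)%:~R \is a @GRing.unit R) ->
    (\sum_(0 <= k < n) (f k)%:~R / (g k)%:~R) * X%:~R = Y%:~R :> rat ->
  (\sum_(0 <= k < n) (f k)%:~R / (g k)%:~R) * X%:~R = Y%:~R :> R.
Proof.
move=> g0 ug e.
have WX : W * X = Y * V.
  apply: (@intr_inj rat); rewrite !rmorphM /= -sum_common_denominator.
    by rewrite mulrAC e.
  by move=> k kn; rewrite unitfE intr_eq0 g0.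
have uV : (V%:~R : R) \is a GRing.unit.
  rewrite rmorph_prod big_nat; apply: (big_ind (fun x : R => x \is a GRing.unit)).
  - exact: unitr1.
  - by move=> u v hu hv; rewrite unitrM hu.
  - by move=> k /andP[_ kn]; exact: ug.
apply: (mulIr uV); rewrite mulrAC sum_common_denominator // -!rmorphM.
by rewrite WX.
Qed.
End RatTransfer.

Lemma pochhammer_opp_nat (a k : nat) : (k <= a)%N ->
  pochhammer (- a%:Z) k = (-1) ^+ k * 'C(a, k)%:Z * k`!%:Z.
Proof.
move=> ka; rewrite -mulrA -PoszM bin_ffact.
elim: k ka => [|k IH] ka; first by rewrite pochhammer0.
have -> : pochhammer (- a%:Z) k.+1 = pochhammer (- a%:Z) k * - (a - k)%N%:Z.
  by rewrite pochhammerS natz; congr (_ * _); lia.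
by rewrite (IH (ltnW ka)) ffactnSr exprS PoszM; ring.
Qed.

Lemma pochhammer1 k : pochhammer (1 : int) k = k`!%:Z.
Proof.
elim: k => [|k IH]; first by rewrite pochhammer0.
by rewrite pochhammerS IH factS natz mulnC PoszM; congr (_ * _); lia.
Qed.

Lemma mulr_inv_eq (R : comUnitRingType) (e u v : R) :
  u \is a GRing.unit -> v \is a GRing.unit -> e * u = e * v -> e / u = e / v.
Proof.
move=> uu uv h; apply: (mulIr uu); rewrite mulrVK // mulrAC h.
by rewrite mulrK.
Qed.

Lemma ndvdz_shift (p : nat) (z w s : int) :
  z = p%:Z * w + s -> s != 0 -> (`|s| < p)%N -> ~~ (p %| z)%Z.
Proof. by move=> -> s0 sp; rewrite rpredDl ?dvdz_mulr // dvdz_small_nat. Qed.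

Section Terms.
Variables (p : nat) (R : comUnitRingType).
Hypothesis pr_p : prime p.
Hypothesis p_gt3 : (3 < p)%N.
Hypothesis unitZ : forall z : int, ~~ (p %| z)%Z -> (z%:~R : R) \is a GRing.unit.
Hypothesis p4 : (p%:R : R) ^+ 4 = 0.
Local Notation nu := (coprime_inv p R).
Local Notation M := (coprime_poch p).
Local Notation N := (coprime_harm p R).
Local Notation x := ((p%:R : R) ^+ 2).
Variables (delta t a : nat).
Hypothesis dt : (2 * delta + a = p * t)%N.
Hypothesis a_gt0 : (0 < a)%N.
Hypothesis a_ltp : (a < p)%N.
Local Notation d := (delta%:Z).

(** With [2 delta] for [alpha], the second parameter [4 d + a - 2 xi] is [alpha + p t - 2 xi]. *)
Definition dixon_num (xi : int) k : int :=
  (-1) ^+ k * 'C(a, k)%:Z * pochhammer (2 * (d + xi)) k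
  * pochhammer (4 * d + a%:Z - 2 * xi) k.
Definition dixon_den (xi : int) k : int :=
  pochhammer (1 - 2 * d - a%:Z + 4 * xi) k * pochhammer (1 + 2 * d + a%:Z + 2 * xi) k.
Definition dixon_frac xi k : R := (dixon_num xi k)%:~R / (dixon_den xi k)%:~R.

Definition sqr_harm k : R := \sum_(0 <= i < k) nu (1 + i%:Z) ^+ 2.
Definition sqr_harm_back k : R := \sum_(0 <= i < k) nu (- a%:Z + i%:Z) ^+ 2.

Section Multiple.
Variable w : int.
Let xi := p%:Z * (p%:Z * w).

Lemma dixon_num_coprime k : (k <= a)%N -> dixon_num xi k =
  (-1) ^+ k * 'C(a, k)%:Z * M (2 * d + 2 * xi) k * M (4 * d + a%:Z - 2 * xi) k.
Proof.
move=> ka; rewrite /dixon_num mulrDr; congr (_ * _ * _);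
  apply: pochhammer_coprime => i ik.
  apply: (@ndvdz_shift _ _ (t%:Z + 2 * (p%:Z * w)) (i%:Z - a%:Z)); [|lia|lia].
  by rewrite /xi; move: dt => /(congr1 Posz); rewrite !(PoszD, PoszM); lia.
apply: (@ndvdz_shift _ _ (2 * t%:Z - 2 * (p%:Z * w)) (i%:Z - a%:Z)); [|lia|lia].
by rewrite /xi; move: dt => /(congr1 Posz); rewrite !(PoszD, PoszM); lia.
Qed.

Lemma dixon_den_coprime k : (k <= a)%N -> dixon_den xi k =
  M (1 - 2 * d - a%:Z + 4 * xi) k * M (1 + 2 * d + a%:Z + 2 * xi) k.
Proof.
move=> ka; rewrite /dixon_den; congr (_ * _); apply: pochhammer_coprime => i ik.
  apply: (@ndvdz_shift _ _ (- t%:Z + 4 * (p%:Z * w)) (1 + i%:Z)); [|lia|lia].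
  by rewrite /xi; move: dt => /(congr1 Posz); rewrite !(PoszD, PoszM); lia.
apply: (@ndvdz_shift _ _ (t%:Z + 2 * (p%:Z * w)) (1 + i%:Z)); [|lia|lia].
by rewrite /xi; move: dt => /(congr1 Posz); rewrite !(PoszD, PoszM); lia.
Qed.

End Multiple.
Lemma xx0 : x * x = 0.
Proof. by rewrite -exprD p4. Qed.

Lemma poch_shift_pp z (c : int) n :
  (M (z + c * (p%:Z * p%:Z)) n)%:~R = (M z n)%:~R * (1 + x * (c%:~R * N z n)) :> R.
Proof.
have h : (1 : R) * (p%:Z * (p%:Z * c))%:~R ^+ 2 = 0.
  rewrite mul1r !intr_p; transitivity ((p%:R : R) ^+ 4 * c%:~R ^+ 2); first by ring.
  by rewrite p4 mul0r.
have := @coprime_poch_shift p R unitZ 1 z _ n (dvd_pM p (p%:Z * c)) h.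
rewrite !mul1r (_ : p%:Z * (p%:Z * c) = c * (p%:Z * p%:Z)); last by ring.
by move=> ->; rewrite !rmorphM /=; congr (_ * (1 + _)); ring.
Qed.

Lemma dixon_frac_expand k : (k <= a)%N ->
  dixon_frac (p%:Z * p%:Z) k = dixon_frac 0 k + x * (dixon_frac 0 k *
    (2 * N (2 * d) k - 2 * N (4 * d + a%:Z) k - 4 * N (1 - 2 * d - a%:Z) k
     - 2 * N (1 + 2 * d + a%:Z) k)).
Proof.
move=> ka.
have n1 := dixon_num_coprime 1 ka; have d1 := dixon_den_coprime 1 ka.
have n0 := dixon_num_coprime 0 ka; have d0 := dixon_den_coprime 0 ka.
rewrite !mulr0 ?subr0 ?addr0 in n0 d0; rewrite !mulr1 in n1 d1.
rewrite -mulNr in n1.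
rewrite /dixon_frac n0 n1 d0 d1 !rmorphM /= !poch_shift_pp.
set A := (M (2 * d) k)%:~R; set B := (M (4 * d + a%:Z) k)%:~R.
set D := (M (1 - 2 * d - a%:Z) k)%:~R; set E := (M (1 + 2 * d + a%:Z) k)%:~R.
set nA := N (2 * d) k; set nB := N (4 * d + a%:Z) k.
set nD := N (1 - 2 * d - a%:Z) k; set nE := N (1 + 2 * d + a%:Z) k.
have uD : D \is a GRing.unit by apply: coprime_poch_unit.
have uE : E \is a GRing.unit by apply: coprime_poch_unit.
have uD' : D * (1 + x * (4%:~R * nD)) \is a GRing.unit.
  by rewrite -poch_shift_pp; apply: coprime_poch_unit.
have uE' : E * (1 + x * (2%:~R * nE)) \is a GRing.unit.
  by rewrite -poch_shift_pp; apply: coprime_poch_unit.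
set C : R := (_ * 'C(a, k)%:~R); set u0 := C * A * B / (D * E).
have h0 : u0 * D * E = C * A * B by rewrite -mulrA mulrVK // unitrM uD.
apply: (mulIr uD'); apply: (mulIr uE').
rewrite -[LHS]mulrA mulrVK; last by rewrite unitrM uD'.
apply/eqP; rewrite -subr_eq0; apply/eqP.
pose s := 2 * nA - 2 * nB - 4 * nD - 2 * nE.
transitivity (C * A * B * ((1 + x * (2 * nA)) * (1 - x * (2 * nB)))
   - u0 * D * E * ((1 + x * s) * (1 + x * (4 * nD)) * (1 + x * (2 * nE)))).
  by rewrite /s; ring.
rewrite h0 -mulrBr.
transitivity (C * A * B * (x * x * (- 4 * nA * nB - s * (4 * nD) - s * (2 * nE)
   - 8 * nD * nE - x * (s * (8 * nD * nE))))); first by rewrite /s; ring.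
by rewrite xx0 mul0r mulr0.
Qed.

Lemma harm_shift_p z w n : x * N (z + p%:Z * w) n =
  x * (N z n - p%:R * w%:~R * \sum_(0 <= i < n) nu (z + i%:Z) ^+ 2).
Proof. by rewrite (coprime_harm_shift unitZ) ?dvd_pM ?pp_shift // intr_p. Qed.

(** Modulo [p] both numerator parameters are [- a], with opposite weights, and both denominator
    parameters are [1], which leaves [- 6 N 1 k]. The shifts by [p t], [2 p t], [- p t] and [p t]
    produce the sums of inverse squares. *)
Lemma log_term_expand k :
  x * (2 * N (2 * d) k - 2 * N (4 * d + a%:Z) k - 4 * N (1 - 2 * d - a%:Z) k
     - 2 * N (1 + 2 * d + a%:Z) k)
  = x * (- 6 * N 1 k + 2 * p%:R * t%:R * (sqr_harm_back k - sqr_harm k)).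
Proof.
have z1 : 2 * d = - a%:Z + p%:Z * t%:Z by lia.
have z2 : 4 * d + a%:Z = - a%:Z + p%:Z * (2 * t%:Z) by lia.
have z3 : 1 - 2 * d - a%:Z = 1 + p%:Z * (- t%:Z) by lia.
have z4 : 1 + 2 * d + a%:Z = 1 + p%:Z * t%:Z by lia.
rewrite z2 z3 z4 z1.
have e1 := harm_shift_p (- a%:Z) t k; have e2 := harm_shift_p (- a%:Z) (2 * t%:Z) k.
have e3 := harm_shift_p 1 (- t%:Z) k; have e4 := harm_shift_p 1 t k.
transitivity (2 * (x * N (- a%:Z + p%:Z * t%:Z) k)
  - 2 * (x * N (- a%:Z + p%:Z * (2 * t%:Z)) k)
  - 4 * (x * N (1 + p%:Z * (- t%:Z)) k) - 2 * (x * N (1 + p%:Z * t%:Z) k)).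
  by ring.
rewrite e1 e2 e3 e4 rmorphM rmorphN /= /sqr_harm /sqr_harm_back.
by ring.
Qed.

Lemma poch_sym_p z w n :
  x * ((M (z + p%:Z * w) n)%:~R * (M (z - p%:Z * w) n)%:~R) = x * (M z n)%:~R ^+ 2.
Proof.
have h := pp_shift p4 w; have h' := pp_shift p4 (- w).
have e1 := @coprime_poch_shift p R unitZ x z _ n (dvd_pM p w) h.
have e2 := @coprime_poch_shift p R unitZ x z _ n (dvd_pM p (- w)) h'.
move: e1 e2; rewrite mulrN rmorphN /=.
set A := (M (z + _) n)%:~R; set B := (M (z - _) n)%:~R; set C := (M z n)%:~R.
move: h; set D := (_ * w)%:~R => h e1 e2.
transitivity (x * A * B); first by rewrite mulrA.
rewrite e1; transitivity (x * B * (C * (1 + D * N z n))); first by ring.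
rewrite e2; transitivity (x * C ^+ 2 - x * D ^+ 2 * (C * N z n) ^+ 2); first by ring.
by rewrite h mul0r subr0.
Qed.

Definition harmonic_term k : R := (pochhammer (2 * d) k)%:~R ^+ 3 / (k`!%:R) ^+ 3.

Lemma fact_unit k : (k < p)%N -> (k`!%:R : R) \is a GRing.unit.
Proof.
move=> kp; apply: (unitZ (z := k`!)); rewrite dvdzE /=.
elim: k kp => [|k IH] kp; first by rewrite fact0 dvdn1 neq_ltn prime_gt1 ?orbT.
have {}IH := IH (ltnW kp).
by rewrite factS Euclid_dvdM // negb_or IH andbT gtnNdvd.
Qed.

Lemma coprime_poch_alpha k : (k <= a)%N -> pochhammer (2 * d) k = M (2 * d) k.
Proof.
move=> ka; apply: pochhammer_coprime => i ik.
by apply: (@ndvdz_shift _ _ t%:Z (i%:Z - a%:Z)); lia.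
Qed.

Lemma coprime_poch_fact k : (k <= a)%N -> k`!%:Z = M 1 k.
Proof.
move=> ka; rewrite -pochhammer1; apply: pochhammer_coprime => i ik.
by apply: dvdz_small_nat; lia.
Qed.

Lemma coprime_poch_bin k : (k <= a)%N -> M (- a%:Z) k = (-1) ^+ k * 'C(a, k)%:Z * k`!%:Z.
Proof.
move=> ka; rewrite -pochhammer_opp_nat //; apply/esym/pochhammer_coprime => i ik.
by apply: dvdz_small_nat; lia.
Qed.

(** The signed binomial is [(alpha - p t)_k / k!], so the parameters come in pairs [alpha -+ p t]
    and [1 -+ p t], whose products have no first-order term in [p t]. *)
Lemma dixon_frac_mod_pp k : (k <= a)%N -> x * dixon_frac 0 k = x * harmonic_term k.
Proof.
move=> ka; have uk : ((M 1 k)%:~R : R) \is a GRing.unit by apply: coprime_poch_unit.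
have n0 := dixon_num_coprime 0 ka; have d0 := dixon_den_coprime 0 ka.
rewrite !mulr0 ?subr0 ?addr0 in n0 d0.
rewrite /dixon_frac n0 d0 /harmonic_term coprime_poch_alpha //.
have -> : k`!%:R = (M 1 k)%:~R :> R by rewrite -coprime_poch_fact.
have s1 := poch_sym_p 1 t k; have s2 := poch_sym_p (2 * d) t k.
have b := coprime_poch_bin ka; have ff := coprime_poch_fact ka.
have z3 : 1 - 2 * d - a%:Z = 1 - p%:Z * t%:Z by lia.
have z4 : 1 + 2 * d + a%:Z = 1 + p%:Z * t%:Z by lia.
have z5 : - a%:Z = 2 * d - p%:Z * t%:Z by lia.
have z6 : 4 * d + a%:Z = 2 * d + p%:Z * t%:Z by lia.
rewrite z3 z4 z6; rewrite z5 ff in b.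
set A := M (2 * d) k in s2 *; set F := M 1 k in s1 b uk *.
set B := M (2 * d + _) k in s2 *; set D := M (1 - _) k in s1 *.
set E := M (1 + _) k in s1 *.
have uD : (D%:~R : R) \is a GRing.unit by apply: coprime_poch_unit.
have uE : (E%:~R : R) \is a GRing.unit by apply: coprime_poch_unit.
transitivity (x * (B%:~R * (M (2 * d - p%:Z * t%:Z) k)%:~R) * A%:~R / F%:~R
   / (E%:~R * D%:~R)).
  rewrite b !rmorphM /= (mulrC E%:~R) [LHS]mulrA; congr (_ / _).
  by rewrite -[LHS](mulrK uk); ring.
rewrite s2.
have -> : x * A%:~R ^+ 2 * A%:~R / F%:~R / (E%:~R * D%:~R) =
   x / (E%:~R * D%:~R) * (A%:~R ^+ 3 / F%:~R) by ring.
rewrite (mulr_inv_eq _ _ s1) ?unitrX //; last by rewrite unitrM uE.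
by rewrite -!exprVn; ring.
Qed.

Definition bin_term k : R := (-1) ^+ k * 'C(a, k)%:R ^+ 3.

Lemma bin_termE k : (k <= a)%N ->
  bin_term k = ((M (- a%:Z) k)%:~R / (k`!%:R)) ^+ 3.
Proof.
move=> ka; rewrite coprime_poch_bin // !rmorphM /= rmorph_sign mulrK; last first.
  by rewrite fact_unit // (leq_ltn_trans ka).
by rewrite /bin_term exprMn -exprM mulnC exprM -[in RHS]signr_odd; case: (odd k);
  rewrite ?expr0 ?expr1n // -signr_odd.
Qed.

Lemma poch_mod_p z w n : x * p%:R * (M (z + p%:Z * w) n)%:~R = x * p%:R * (M z n)%:~R.
Proof.
have h : x * p%:R * (p%:Z * w)%:~R ^+ 2 = 0 by rewrite mulrAC pp_shift ?mul0r.
rewrite (@coprime_poch_shift p R unitZ _ z _ n (dvd_pM p w) h) intr_p.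
transitivity (x * p%:R * (M z n)%:~R + (p%:R : R) ^+ 4 * (w%:~R * N z n * (M z n)%:~R)).
  by ring.
by rewrite p4 mul0r addr0.
Qed.

Lemma harmonic_term_mod_p k : (k <= a)%N ->
  x * p%:R * harmonic_term k = x * p%:R * bin_term k.
Proof.
move=> ka; rewrite bin_termE // /harmonic_term coprime_poch_alpha // expr_div_n.
rewrite [LHS]mulrA [RHS]mulrA; congr (_ / _); apply: mul_expr_eq.
by rewrite (_ : 2 * d = - a%:Z + p%:Z * t%:Z) ?poch_mod_p //; lia.
Qed.

(** The sum [E'] of the overview, up to a constant factor. *)
Definition weighted_sqr_harm : R :=
  \sum_(0 <= k < a.+1) bin_term k * (sqr_harm k - sqr_harm_back k).

Lemma dixon_sum_expand :
  \sum_(0 <= k < a.+1) dixon_frac (p%:Z * p%:Z) k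
  = \sum_(0 <= k < a.+1) dixon_frac 0 k
    + (- 6 * (x * \sum_(0 <= k < a.+1) harmonic_term k * N 1 k)
       - 2 * t%:R * (x * p%:R * weighted_sqr_harm)).
Proof.
rewrite /weighted_sqr_harm !mulr_sumr -sumrB -big_split /=.
apply: eq_big_nat => k /andP[_ ka].
rewrite dixon_frac_expand //; congr (_ + _).
rewrite mulrCA log_term_expand mulrCA.
transitivity (x * dixon_frac 0 k * (- 6 * N 1 k) +
  2 * t%:R * p%:R * (sqr_harm_back k - sqr_harm k) * (x * dixon_frac 0 k)).
  by ring.
rewrite dixon_frac_mod_pp //.
transitivity (- 6 * (x * (harmonic_term k * N 1 k)) + 2 * t%:R *
  (sqr_harm_back k - sqr_harm k) * (x * p%:R * harmonic_term k)); first by ring.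
by rewrite harmonic_term_mod_p //; ring.
Qed.

Lemma sqr_harmS k : sqr_harm k.+1 = sqr_harm k + nu k.+1%:Z ^+ 2.
Proof. by rewrite /sqr_harm big_nat_recr. Qed.

Lemma sqr_harm_backE k : (k <= a)%N ->
  sqr_harm_back k = sqr_harm a - sqr_harm (a - k).
Proof.
elim: k => [|k IH] ka; first by rewrite /sqr_harm_back big_nil subn0 subrr.
rewrite /sqr_harm_back big_nat_recr //= -/(sqr_harm_back k) (IH (ltnW ka)).
have -> : (a - k)%N = (a - k.+1).+1 by lia.
rewrite sqr_harmS (_ : - a%:Z + k%:Z = - (a - k.+1).+1%:Z) ?coprime_invN ?sqrrN; last by lia.
by ring.
Qed.

(** Under [k -> a - k] the signed cube changes sign, while the weight [sqr_harm k + sqr_harm (a - k)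
    - sqr_harm a] is invariant. *)
Lemma weighted_sqr_harm_odd : odd a -> weighted_sqr_harm = 0.
Proof.
move=> oa; apply: (double_cancel0 p_gt3 unitZ); rewrite mulr2n.
rewrite {2}/weighted_sqr_harm big_nat_rev /= /weighted_sqr_harm -big_split /=.
rewrite big_nat big1 // => k /andP[_ ka]; rewrite add0n subSS.
rewrite !sqr_harm_backE ?leq_subr // subKn // /bin_term bin_sub //.
rewrite -(signr_odd _ (a - k)) oddB // oa addTb -(signr_odd _ k).
by case: (odd k) => /=; ring.
Qed.

Definition even_num (y : int) k : int :=
  (-1) ^+ k * 'C(a, k)%:Z * \prod_(0 <= i < k) ((a%:Z - i%:Z) ^+ 2 - y).
Definition even_den (y : int) k : int := \prod_(0 <= i < k) (i.+1%:Z ^+ 2 - y).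

(** The perturbation is [y = p ^ 3 w]: its square is zero, and its coefficient matters modulo [p]
    only, the precision required of [weighted_sqr_harm]. *)
Lemma sqr_prod_expand (c : nat -> int) (w : int) n :
    (forall i, (i < n)%N -> ~~ (p %| c i)%Z) ->
  (\prod_(0 <= i < n) (c i ^+ 2 - p%:Z ^+ 3 * w))%:~R =
  (\prod_(0 <= i < n) c i)%:~R ^+ 2 *
    (1 - x * p%:R * w%:~R * \sum_(0 <= i < n) nu (c i) ^+ 2) :> R.
Proof.
move=> hc; pose D : R := - (x * p%:R * w%:~R).
have h : 1 * D ^+ 2 = 0.
  transitivity ((p%:R : R) ^+ 4 * (x * w%:~R ^+ 2)); first by rewrite /D; ring.
  by rewrite p4 mul0r.
have := @prod_first_order R 1 D (fun=> 1) (fun i => (c i)%:~R ^+ 2) n h.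
rewrite !mul1r => e; rewrite !rmorph_prod /=.
transitivity (\prod_(0 <= i < n) ((c i)%:~R ^+ 2 + D * 1)).
  apply: eq_bigr => i _; rewrite rmorphB rmorphXn rmorphM rmorphXn /= /D; congr (_ + _).
  by ring.
rewrite e => [|i ik]; last by rewrite unitrX // unitZ // hc.
rewrite prodrXl /D mulNr; congr (_ * (1 - _ * _)).
apply: eq_big_nat => i /andP[_ ik].
by rewrite /coprime_inv (negbTE (hc i ik)) mul1r exprVn.
Qed.

Definition even_frac y k : R := (even_num y k)%:~R / (even_den y k)%:~R.

Lemma prod_falling k : (k <= a)%N ->
  \prod_(0 <= i < k) (a%:Z - i%:Z) = 'C(a, k)%:Z * k`!%:Z.
Proof.
move=> ka; rewrite -PoszM bin_ffact.
elim: k ka => [|k IH] ka; first by rewrite big_nil.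
by rewrite big_nat_recr //= (IH (ltnW ka)) ffactnSr PoszM; congr (_ * _); lia.
Qed.

Lemma prod_succ k : \prod_(0 <= i < k) i.+1%:Z = k`!%:Z.
Proof.
by elim: k => [|k IH]; rewrite ?big_nil // big_nat_recr //= IH factS mulnC PoszM.
Qed.

Lemma even_den_expand w k : (k <= a)%N -> (even_den (p%:Z ^+ 3 * w) k)%:~R =
  k`!%:R ^+ 2 * (1 - x * p%:R * w%:~R * sqr_harm k) :> R.
Proof.
move=> ka; rewrite /even_den (@sqr_prod_expand (fun i => i.+1%:Z)) ?prod_succ // => i ik.
by apply: dvdz_small_nat; lia.
Qed.

Lemma ppp0 : (x * p%:R) ^+ 2 = 0.
Proof.
by transitivity ((p%:R : R) ^+ 4 * x); [ring | rewrite p4 mul0r].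
Qed.

Lemma even_den_unit w k : (k <= a)%N ->
  ((even_den (p%:Z ^+ 3 * w) k)%:~R : R) \is a GRing.unit.
Proof.
move=> ka; rewrite even_den_expand // unitrM unitrX ?fact_unit ?(leq_ltn_trans ka) //=.
apply/unitrPr; exists (1 + x * p%:R * w%:~R * sqr_harm k).
transitivity (1 - (x * p%:R) ^+ 2 * (w%:~R * sqr_harm k) ^+ 2 : R); first by ring.
by rewrite ppp0 mul0r subr0.
Qed.

Lemma even_frac_expand w k : (k <= a)%N -> even_frac (p%:Z ^+ 3 * w) k =
  bin_term k + x * p%:R * w%:~R * (bin_term k * (sqr_harm k - sqr_harm_back k)).
Proof.
move=> ka; apply: (mulIr (even_den_unit w ka)).
rewrite /even_frac mulrVK ?even_den_unit // even_den_expand // /even_num rmorphM /=.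
rewrite (@sqr_prod_expand (fun i => a%:Z - i%:Z)) => [|i ik]; last first.
  by apply: dvdz_small_nat; lia.
rewrite prod_falling // !rmorphM rmorph_sign /= /bin_term.
have -> : \sum_(0 <= i < k) nu (a%:Z - i%:Z) ^+ 2 = sqr_harm_back k.
  apply: eq_bigr => i _; rewrite (_ : - a%:Z + i%:Z = - (a%:Z - i%:Z)); last by lia.
  by rewrite coprime_invN sqrrN.
apply/eqP; rewrite -subr_eq0; apply/eqP.
transitivity ((x * p%:R) ^+ 2 * ((-1) ^+ k * 'C(a, k)%:R ^+ 3 * k`!%:R ^+ 2 *
  w%:~R ^+ 2 * sqr_harm k * (sqr_harm k - sqr_harm_back k)) : R).
  by ring.
by rewrite ppp0 mul0r.
Qed.

(** The choice [y = - c p ^ 3] with [c > 0] makes every [i ^ 2 - y] positive, including at [i = 0],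
    as [even_dixon_sum] requires over the rationals. *)
Lemma even_frac_sum m (c : nat) : a = m.*2 -> (0 < c)%N ->
  (\sum_(0 <= k < a.+1) even_frac (p%:Z ^+ 3 * - c%:Z) k)
    * (m`!%:R ^+ 3 * (1 + x * p%:R * c%:R * sqr_harm m))
  = (-1) ^+ m * (3 * m)`!%:R.
Proof.
move=> am c0; set y := p%:Z ^+ 3 * _.
have y0 : y < 0.
  by rewrite /y mulrN oppr_lt0 mulr_gt0 // ?exprn_gt0 // ltz_nat prime_gt0.
have ny (F : numFieldType) (i : nat) : i%:R ^+ 2 - y%:~R != 0 :> F.
  rewrite gt_eqF // subr_gt0 (@lt_le_trans _ _ 0) ?ltrz0 // exprn_ge0 //.
have := @rat_sum_transfer (even_num y) (even_den y) a.+1 R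
  (even_den y m * m`!%:Z) ((-1) ^+ m * (3 * m)`!%:Z).
rewrite !rmorphM !rmorph_sign /= {2}/y even_den_expand; last by lia.
move=> h; rewrite -h.
- by rewrite rmorphN /= /even_frac; congr (_ * _); ring.
- move=> k _; rewrite /even_den; elim: k => [|k IH]; first by rewrite big_nil.
  rewrite big_nat_recr //= mulf_neq0 //; have := ny rat k.+1.
  by rewrite -(intr_eq0 rat) rmorphB rmorphXn /=.
- by move=> k; rewrite ltnS => ka; apply: even_den_unit.
clearbody y; have := @even_dixon_sum rat y%:~R (ny rat) m.
rewrite mulrAC mulrC -am => e.
transitivity ((\sum_(0 <= k < a.+1) even_term (y%:~R : rat) a k) *
  (\prod_(0 <= j < m) (j.+1%:R ^+ 2 - y%:~R) * m`!%:R)); last by rewrite e.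
congr (_ * _); last first.
  rewrite /even_den rmorph_prod /=; congr (_ * _); apply: eq_bigr => j _.
  by rewrite rmorphB rmorphXn.
apply: eq_bigr => k _; rewrite /even_num /even_den /even_term /even_weight.
rewrite !rmorphM rmorph_sign /= !rmorph_prod /= prodf_div [RHS]mulrA; congr (_ * _ / _).
  apply: eq_bigr => i _; by rewrite rmorphB rmorphXn rmorphB /=.
by apply: eq_bigr => i _; rewrite rmorphB rmorphXn.
Qed.

Lemma weighted_sqr_harm_even m : a = m.*2 ->
  x * p%:R * weighted_sqr_harm
  = x * p%:R * (\sum_(0 <= k < a.+1) bin_term k) * sqr_harm m.
Proof.
move=> am; pose B : R := \sum_(0 <= k < a.+1) bin_term k.
have e c : (0 < c)%N -> (B - x * p%:R * c%:R * weighted_sqr_harm)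
    * (m`!%:R ^+ 3 * (1 + x * p%:R * c%:R * sqr_harm m)) = (-1) ^+ m * (3 * m)`!%:R.
  move=> c0; rewrite -(even_frac_sum am c0); congr (_ * _).
  rewrite /B /weighted_sqr_harm -mulNr mulr_sumr -big_split.
  apply: eq_big_nat => k /andP[_ ka]; rewrite even_frac_expand //.
  by rewrite rmorphN /= mulrN.
have u : (m`!%:R ^+ 3 : R) \is a GRing.unit.
  by rewrite unitrX // fact_unit //; lia.
(* The right-hand side is independent of [c], so comparing [c = 1] with [c = 2] isolates the
   first-order coefficient; [c = 0] is excluded by positivity. *)
have := e 1%N isT; rewrite -(e 2%N isT) => h; apply: (mulIr u).
apply/eqP; rewrite -subr_eq0 -/B; apply/eqP.
transitivity ((B - x * p%:R * 1 * weighted_sqr_harm)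
    * (m`!%:R ^+ 3 * (1 + x * p%:R * 1 * sqr_harm m))
  - (B - x * p%:R * 2 * weighted_sqr_harm)
    * (m`!%:R ^+ 3 * (1 + x * p%:R * 2 * sqr_harm m))
  - (x * p%:R) ^+ 2 * (3 * weighted_sqr_harm * sqr_harm m * m`!%:R ^+ 3) : R).
  by ring.
by rewrite h subrr ppp0 mul0r subr0.
Qed.
End Terms.

(** * Evaluation of the Dixon sum *)

Section Evaluation.
Variables (p : nat) (R : comUnitRingType).
Hypothesis pr_p : prime p.
Hypothesis p_gt3 : (3 < p)%N.
Hypothesis unitZ : forall z : int, ~~ (p %| z)%Z -> (z%:~R : R) \is a GRing.unit.
Hypothesis p4 : (p%:R : R) ^+ 4 = 0.
Local Notation nu := (coprime_inv p R).
Local Notation M := (coprime_poch p).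
Local Notation N := (coprime_harm p R).
Local Notation x := ((p%:R : R) ^+ 2).
Variables (delta t a : nat).
Hypothesis dt : (2 * delta + a = p * t)%N.
Hypothesis a_gt0 : (0 < a)%N.
Hypothesis a_ltp : (a < p)%N.
Local Notation d := (delta%:Z).

Section Xi.
Variable w : nat.
Let xi := (p%:Z * (p%:Z * w%:Z)).

(** The common factor [z] may be divisible by [p], so it is cancelled over the rationals, before the
    transfer to [R]. *)
Lemma dixon_frac_sum (X Y z : int) : z != 0 ->
    pochhammer (1 + (d + xi)) a * pochhammer (1 - 2 * d - a%:Z + 4 * xi) a = X * z ->
    pochhammer (1 + 2 * (d + xi)) a * pochhammer (1 - 3 * d - a%:Z + 3 * xi) a = Y * z ->
  (\sum_(0 <= k < a.+1) dixon_frac R delta a xi k) * X%:~R = Y%:~R.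
Proof.
move=> z0 eX eY.
have den0 k i : (i < k)%N -> (k <= a)%N ->
    ~~ (p %| 1 - 2 * d - a%:Z + 4 * xi + i%:Z)%Z.
  move=> ik ka; apply: (@ndvdz_shift _ _ (- t%:Z + 4 * (p%:Z * w)) (1 + i%:Z)); [|lia|lia].
  by rewrite /xi; move: dt => /(congr1 Posz); rewrite !(PoszD, PoszM); lia.
have xi0 : 0 <= xi by rewrite /xi !mulr_ge0.
apply: rat_sum_transfer.
- move=> k ka; rewrite /dixon_den mulf_neq0 // pochhammer_neq0 // => i ik.
    by apply: contraNneq (den0 _ _ ik ka) ; rewrite (natz i) => ->; rewrite dvdz0.
  by rewrite (natz i); lia.
- move=> k ka; rewrite /dixon_den -/(dixon_den delta a xi k).
  rewrite (dixon_den_coprime pr_p p_gt3 dt a_gt0 a_ltp w) //.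
  by rewrite rmorphM unitrM !coprime_poch_unit.
set c := (d + xi)%:~R : rat; set B := (4 * d + a%:Z - 2 * xi)%:~R : rat.
have eA : (2 * (d + xi))%:~R = 2 * c :> rat by rewrite rmorphM.
have eB : (1 - 2 * d - a%:Z + 4 * xi)%:~R = 1 + 2 * c - B :> rat.
  by rewrite /c /B !(rmorphM, rmorphD, rmorphB, rmorph1, rmorph_nat) /=; ring.
have eC : (1 + 2 * d + a%:Z + 2 * xi)%:~R = 1 + 2 * c + a%:R :> rat.
  by rewrite /c !(rmorphM, rmorphD, rmorphB, rmorph1, rmorph_nat) /=; ring.
have eD : (1 - 3 * d - a%:Z + 3 * xi)%:~R = 1 + c - B :> rat.
  by rewrite /c /B !(rmorphM, rmorphD, rmorphB, rmorph1, rmorph_nat) /=; ring.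
have eE : (1 + (d + xi))%:~R = 1 + c :> rat by rewrite rmorphD.
have eF : (1 + 2 * (d + xi))%:~R = 1 + 2 * c :> rat by rewrite rmorphD rmorphM.
have := @dixon_sum rat c B a.
have -> : \sum_(0 <= k < a.+1) dixon_term c B a k =
   \sum_(0 <= k < a.+1) (dixon_num delta a xi k)%:~R / (dixon_den delta a xi k)%:~R.
  apply: eq_bigr => k _; rewrite /dixon_term /dixon_num /dixon_den !rmorphM rmorph_sign /=.
  by rewrite !rmorph_pochhammer /= eA eB eC.
have {}eX := congr1 (intmul (1 : rat)) eX; have {}eY := congr1 (intmul (1 : rat)) eY.
move: eX eY; rewrite !rmorphM /= !rmorph_pochhammer /= eB eD eE eF => -> -> h.
have zr : z%:~R != 0 :> rat by rewrite intr_eq0.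
apply: (mulIf zr); rewrite -mulrA; apply: h => i ia.
  rewrite -eB -[i%:R]/(i%:Z%:~R) -rmorphD intr_eq0.
  by apply: contraNneq (den0 a i ia (leqnn a)) => ->; rewrite dvdz0.
rewrite -eF -[i%:R]/(i%:Z%:~R) -rmorphD intr_eq0.
by lia.
Qed.

Local Notation A := (M (1 + 2 * (d + xi)) a).
Local Notation B := (M (1 - 3 * d - a%:Z + 3 * xi) a).
Local Notation C := (M (1 + (d + xi)) a).
Local Notation E := (M (1 - 2 * d - a%:Z + 4 * xi) a).
Local Notation D := (\sum_(0 <= k < a.+1) dixon_frac R delta a xi k).

(** For odd [a], [d] is [- a / 2] modulo [p]; doubling keeps the residues explicit. *)
Lemma ndvdz_double (z v s : int) :
  2 * z = p%:Z * v + s -> s != 0 -> (`|s| < p)%N -> ~~ (p %| z)%Z.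
Proof.
move=> e s0 sp; have := ndvdz_shift e s0 sp.
by apply: contra; apply: dvdz_mull.
Qed.

Let dtZ : 2 * d + a%:Z = p%:Z * t%:Z. Proof. lia. Qed.
Let xiE : xi = p%:Z * (p%:Z * w%:Z). Proof. by []. Qed.

Lemma half_evenE s m : a = m.*2 -> t = s.*2 -> d + m%:Z = p%:Z * s%:Z.
Proof. by move: dtZ => + am ts; rewrite am ts; lia. Qed.

Lemma poch_alpha : pochhammer (1 + 2 * (d + xi)) a = (p%:Z * t%:Z + 2 * xi) * A.
Proof.
have e : 1 + 2 * (d + xi) + a.-1%:Z = p%:Z * t%:Z + 2 * xi by lia.
rewrite (@pochhammer_one_dvd p _ a a.-1) ?e //; [lia|lia|].
by apply/dvdzP; exists (t%:Z + 2 * (p%:Z * w%:Z)); rewrite xiE; ring.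
Qed.

Lemma poch_den : pochhammer (1 - 2 * d - a%:Z + 4 * xi) a = E.
Proof.
apply: pochhammer_coprime => i ia.
by apply: (@ndvdz_shift _ _ (- t%:Z + 4 * (p%:Z * w)) (1 + i%:Z)); lia.
Qed.

Lemma poch_half_even s m : a = m.*2 -> t = s.*2 ->
  pochhammer (1 + (d + xi)) a = (p%:Z * s%:Z + xi) * C.
Proof.
move=> am ts.
(* Since [d + m = p s], the factor divisible by [p] has index [m - 1]. *)
have e : 1 + (d + xi) + m.-1%:Z = p%:Z * s%:Z + xi.
  by have := half_evenE am ts; lia.
rewrite (@pochhammer_one_dvd p _ a m.-1) ?e //; [lia|lia|].
by apply/dvdzP; exists (s%:Z + p%:Z * w%:Z); rewrite xiE; ring.
Qed.

Lemma poch_half_odd : odd a -> pochhammer (1 + (d + xi)) a = C.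
Proof.
move=> oa; apply: pochhammer_coprime => i ia.
have := odd_double_half a; rewrite oa => ah.
by apply: (@ndvdz_double _ (t%:Z + 2 * (p%:Z * w)) (2 + 2 * i%:Z - a%:Z)); lia.
Qed.

Lemma poch_three_small_even s m : a = m.*2 -> t = s.*2 -> (3 * a < 2 * p)%N ->
  pochhammer (1 - 3 * d - a%:Z + 3 * xi) a = B.
Proof.
move=> am ts ap; apply: pochhammer_coprime => i ia.
apply: (@ndvdz_shift _ _ (- 3 * s%:Z + 3 * (p%:Z * w)) (1 + i%:Z + m%:Z)); [|lia|lia].
by have := half_evenE am ts; lia.
Qed.

Lemma poch_three_big_even s m : a = m.*2 -> t = s.*2 -> (2 * p <= 3 * a)%N ->
  pochhammer (1 - 3 * d - a%:Z + 3 * xi) a = (p%:Z - 3 * (p%:Z * s%:Z) + 3 * xi) * B.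
Proof.
move=> am ts ap.
(* The factor of index [i] is [1 + i + m] modulo [p]; it is divisible by [p] at [i = p - m - 1], an
   index below [a] exactly when [2 p <= 3 a]. *)
have e : 1 - 3 * d - a%:Z + 3 * xi + (p - m.+1)%N%:Z = p%:Z - 3 * (p%:Z * s%:Z) + 3 * xi.
  by have := half_evenE am ts; lia.
rewrite (@pochhammer_one_dvd p _ a (p - m.+1)%N) ?e //; [lia|lia|].
by apply/dvdzP; exists (1 - 3 * s%:Z + 3 * (p%:Z * w%:Z)); rewrite xiE; ring.
Qed.

Lemma poch_three_small_odd : odd a -> (3 * a < p)%N ->
  pochhammer (1 - 3 * d - a%:Z + 3 * xi) a = B.
Proof.
move=> oa ap; apply: pochhammer_coprime => i ia.
have := odd_double_half a; rewrite oa => ah.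
by apply: (@ndvdz_double _ (- 3 * t%:Z + 6 * (p%:Z * w)) (2 + 2 * i%:Z + a%:Z)); lia.
Qed.

Lemma poch_three_big_odd u : odd a -> t = u.*2.+1 -> (p <= 3 * a)%N ->
  pochhammer (1 - 3 * d - a%:Z + 3 * xi) a
  = (- (p%:Z * (1 + 3 * u%:Z)) + 3 * xi) * B.
Proof.
move=> oa tu ap; have := odd_double_half a; rewrite oa add1n => ah.
have := odd_double_half p; rewrite (odd_p pr_p p_gt3) add1n => ph.
(* Twice the factor of index [i] is [2 + 2 i + a] modulo [p], which equals [p] at this index. *)
have e : 1 - 3 * d - a%:Z + 3 * xi + (p./2 - (a./2).+1)%N%:Z
    = - (p%:Z * (1 + 3 * u%:Z)) + 3 * xi.
  have : 2 * d + a%:Z = p%:Z + 2 * (p%:Z * u%:Z) by move: dtZ; rewrite tu; lia.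
  by lia.
rewrite (@pochhammer_one_dvd p _ a (p./2 - (a./2).+1)%N) ?e //; [lia|lia|].
by apply/dvdzP; exists (- (1 + 3 * u%:Z) + 3 * (p%:Z * w%:Z)); rewrite xiE; ring.
Qed.

Lemma half_even s m : a = m.*2 -> t = s.*2 -> p%:Z * s%:Z + xi != 0.
Proof.
move=> am ts; have := half_evenE am ts.
have : 0 <= xi by rewrite /xi !mulr_ge0.
by lia.
Qed.

(** The divisible factors [p t + 2 xi] above and [p s + xi] below have quotient 2. *)
Lemma dixon_eval_small_even s m : a = m.*2 -> t = s.*2 -> (3 * a < 2 * p)%N ->
  D * (C * E)%:~R = (A * B)%:~R * 2%:~R.
Proof.
move=> am ts ap; rewrite -rmorphM; apply: (dixon_frac_sum (half_even am ts)).
  by rewrite (poch_half_even am ts) poch_den; ring.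
by rewrite poch_alpha (poch_three_small_even am ts ap) ts -muln2 PoszM; ring.
Qed.

Lemma dixon_eval_big_even s m : a = m.*2 -> t = s.*2 -> (2 * p <= 3 * a)%N ->
  D * (C * E)%:~R = (A * B)%:~R * (2 * (p%:Z - 3 * (p%:Z * s%:Z) + 3 * xi))%:~R.
Proof.
move=> am ts ap; rewrite -rmorphM; apply: (dixon_frac_sum (half_even am ts)).
  by rewrite (poch_half_even am ts) poch_den; ring.
by rewrite poch_alpha (poch_three_big_even am ts ap) ts -muln2 PoszM; ring.
Qed.

Lemma dixon_eval_small_odd : odd a -> (3 * a < p)%N ->
  D * (C * E)%:~R = (A * B)%:~R * (p%:Z * t%:Z + 2 * xi)%:~R.
Proof.
move=> oa ap; rewrite -rmorphM; apply: (@dixon_frac_sum _ _ 1) => //.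
  by rewrite (poch_half_odd oa) poch_den; ring.
by rewrite poch_alpha (poch_three_small_odd oa ap); ring.
Qed.

Lemma dixon_eval_big_odd u : odd a -> t = u.*2.+1 -> (p <= 3 * a)%N ->
  D * (C * E)%:~R = (A * B)%:~R *
    ((p%:Z * t%:Z + 2 * xi) * (- (p%:Z * (1 + 3 * u%:Z)) + 3 * xi))%:~R.
Proof.
move=> oa tu ap; rewrite -rmorphM; apply: (@dixon_frac_sum _ _ 1) => //.
  by rewrite (poch_half_odd oa) poch_den; ring.
by rewrite poch_alpha (poch_three_big_odd oa tu ap); ring.
Qed.
End Xi.
End Evaluation.

(** * The congruences in Z / p ^ 4 *)

Section Congruence.
Variables (p : nat) (R : comUnitRingType).
Hypothesis pr_p : prime p.
Hypothesis p_gt3 : (3 < p)%N.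
Hypothesis unitZ : forall z : int, ~~ (p %| z)%Z -> (z%:~R : R) \is a GRing.unit.
Hypothesis p4 : (p%:R : R) ^+ 4 = 0.
Local Notation nu := (coprime_inv p R).
Local Notation M := (coprime_poch p).
Local Notation N := (coprime_harm p R).
Local Notation x := ((p%:R : R) ^+ 2).
Variables (delta t a : nat).
Hypothesis dt : (2 * delta + a = p * t)%N.
Hypothesis a_gt0 : (0 < a)%N.
Hypothesis a_ltp : (a < p)%N.
Local Notation d := (delta%:Z).
Variables G H : int -> R.
Hypothesis G0 : G 0 = 1.
Hypothesis GS : forall z, G (z + 1) = - (coprime_factor p z)%:~R * G z.
Hypothesis uG : forall z, G z \is a GRing.unit.
Hypothesis H0 : x * H 0 = 0.
Hypothesis HS : forall z, x * H (z + 1) = x * (H z + nu (z + 1)).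

Local Notation A xi := (M (1 + 2 * (d + xi)) a).
Local Notation B xi := (M (1 - 3 * d - a%:Z + 3 * xi) a).
Local Notation C xi := (M (1 + (d + xi)) a).
Local Notation E xi := (M (1 - 2 * d - a%:Z + 4 * xi) a).
Local Notation D xi := (\sum_(0 <= k < a.+1) dixon_frac R delta a xi k).
Local Notation beta := (N (1 - d) p).

Let g : R := G (1 + d) * G (1 - 3 * d) / (G (1 + 2 * d) * G (1 - 2 * d) * G (1 - d) ^+ 2).
Let h : R := H (- (2 * d)) + 2^-1 * H (- d) - 2^-1 * H (- (3 * d)).
Let S : R := \sum_(0 <= k < a.+1) harmonic_term R delta k * N 1 k.
Let N0 : R := (A 0 * B 0)%:~R / (C 0 * E 0)%:~R.

Let uCE xi : ((C xi * E xi)%:~R : R) \is a GRing.unit.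
Proof. by rewrite rmorphM unitrM !coprime_poch_unit. Qed.

Lemma gamma_ratio : x * N0 = x * g.
Proof.
have ug : G (1 + 2 * d) * G (1 - 2 * d) * G (1 - d) ^+ 2 \is a GRing.unit.
  by rewrite !unitrM !uG.
apply: (mulIr (uCE 0)); apply: (mulIr ug).
have -> : x * N0 * (C 0 * E 0)%:~R = x * (A 0 * B 0)%:~R.
  by rewrite /N0 mulrA mulrVK.
rewrite [RHS]mulrAC /g [x * (_ / _)]mulrA mulrVK //.
have := gamma_quotient pr_p p_gt3 unitZ p4 G0 GS dt.
by rewrite !addr0 ?mulr0 ?addr0 !rmorphM /= => ->; ring.
Qed.

(** [L0] and [L1] are the value and the derivative at [xi = 0] of the factor left by the multiples
    of [p]. The derivatives of the two sides of Dixon's evaluation are compared; the last premise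
    makes [weighted_sqr_harm] cancel the [beta] part of [log_derivative]. *)
Lemma dixon_first_order (L0 L1 : R) :
    D 0 * (C 0 * E 0)%:~R = (A 0 * B 0)%:~R * L0 ->
    (let xi := p%:Z * p%:Z in
     D xi * (C xi * E xi)%:~R = (A xi * B xi)%:~R * (L0 + x * L1)) ->
    2 * t%:R * (x * p%:R * weighted_sqr_harm p R a) = - (x * beta * (2 * t%:R * g * L0)) ->
  6 * (x * S) = x * (g * (6 * h * L0 - L1)).
Proof.
move=> /= e0 e1 hE.
have D0 : D 0 = N0 * L0.
  by apply: (mulIr (uCE 0)); rewrite e0 /N0 mulrAC mulrVK.
have xx := xx0 p4; have ps := poch_shift_pp unitZ p4.
have lam := log_derivative pr_p p_gt3 unitZ p4 H0 HS dt.
pose lm : R := 2 * N (1 + 2 * d) a + 3 * N (1 - 3 * d - a%:Z) a - N (1 + d) a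
       - 4 * N (1 - 2 * d - a%:Z) a.
have D1 : D (p%:Z * p%:Z) = N0 * L0 + x * N0 * (lm * L0 + L1).
  have z1 : 1 + 2 * (d + p%:Z * p%:Z) = 1 + 2 * d + 2 * (p%:Z * p%:Z) by ring.
  have z2 : 1 + (d + p%:Z * p%:Z) = 1 + d + 1 * (p%:Z * p%:Z) by ring.
  apply: (mulIr (uCE (p%:Z * p%:Z))); rewrite e1 z1 z2 !rmorphM /= !ps.
  have := uCE 0; rewrite /N0 !addr0 ?mulr0 ?addr0 !rmorphM /=.
  set a1 := (M (1 + 2 * d) a)%:~R; set b1 := (M (1 - 3 * d - a%:Z) a)%:~R.
  set c1 := (M (1 + d) a)%:~R; set f1 := (M (1 - 2 * d - a%:Z) a)%:~R => u1.
  have h1 : a1 * b1 / (c1 * f1) * (c1 * f1) = a1 * b1 by rewrite mulrVK.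
  move: h1; set n0 := a1 * b1 / (c1 * f1) => h1.
  apply/eqP; rewrite -subr_eq0; apply/eqP.
  pose nA := N (1 + 2 * d) a; pose nB := N (1 - 3 * d - a%:Z) a.
  pose nC := N (1 + d) a; pose nE := N (1 - 2 * d - a%:Z) a.
  transitivity (a1 * b1 * ((1 + x * (2 * nA)) * (1 + x * (3 * nB)) * (L0 + x * L1))
     - n0 * (c1 * f1) * ((L0 + x * (lm * L0 + L1)) * (1 + x * nC) * (1 + x * (4 * nE)))).
    by rewrite /nA /nB /nC /nE; ring.
  rewrite h1.
  transitivity (x * x * (a1 * b1 * (L0 * (6 * nA * nB - lm * (nC + 4 * nE) - 4 * nC * nE)
    + L1 * (2 * nA + 3 * nB - nC - 4 * nE)
    + x * (L1 * (6 * nA * nB - 4 * nC * nE) - 4 * lm * L0 * nC * nE)))).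
    rewrite /lm -/nA -/nB -/nC -/nE.
    by ring.
  by rewrite xx mul0r.
have hh : 2 * H (- (2 * d)) + H (- d) - H (- (3 * d)) = 2 * h.
  by rewrite /h mulrBr mulrDr !mulVKr ?(unit2 p_gt3 unitZ).
rewrite hh in lam.
have := dixon_sum_expand pr_p p_gt3 unitZ p4 dt a_gt0 a_ltp.
rewrite D1 D0 gamma_ratio hE => /addrI e.
have -> : 6 * (x * S) = - (- 6 * (x * S) - - (x * beta * (2 * t%:R * g * L0)))
    + x * beta * (2 * t%:R * g * L0) by ring.
rewrite -e; transitivity (- (g * L0 * (x * lm)) - x * g * L1
    + x * beta * (2 * t%:R * g * L0)); first by ring.
by rewrite lam; ring.
Qed.

Lemma frac_sum_bin : x * p%:R * D 0 = x * p%:R * \sum_(0 <= k < a.+1) bin_term R a k.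
Proof.
rewrite !mulr_sumr; apply: eq_big_nat => k /andP[_ ka].
rewrite mulrAC (dixon_frac_mod_pp pr_p p_gt3 unitZ p4 dt a_gt0 a_ltp) // mulrAC.
exact: (harmonic_term_mod_p pr_p p_gt3 unitZ p4 dt a_gt0 a_ltp).
Qed.

(** Modulo [p] the sum of cubes is [D 0 = g * L0], and [beta] supplies the same sum of inverse
    squares with the opposite sign. *)
Lemma quadratic_even m L0 : a = m.*2 ->
    D 0 * (C 0 * E 0)%:~R = (A 0 * B 0)%:~R * L0 ->
  2 * t%:R * (x * p%:R * weighted_sqr_harm p R a) = - (x * beta * (2 * t%:R * g * L0)).
Proof.
move=> am e0.
have D0 : D 0 = N0 * L0.
  by apply: (mulIr (uCE 0)); rewrite e0 /N0 mulrAC mulrVK.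
rewrite (weighted_sqr_harm_even pr_p p_gt3 unitZ p4 dt a_gt0 a_ltp am).
rewrite -frac_sum_bin D0 (beta_even pr_p p_gt3 unitZ p4 dt am).
transitivity (2 * t%:R * (x * N0) * p%:R * L0 * sqr_harm p R m); first by ring.
by rewrite gamma_ratio /sqr_harm; ring.
Qed.

(** Both sides vanish: the left by symmetry, the right because [L0 = p l] and [p] divides [beta]. *)
Lemma quadratic_odd l : odd a ->
  2 * t%:R * (x * p%:R * weighted_sqr_harm p R a)
  = - (x * beta * (2 * t%:R * g * (p%:R * l))).
Proof.
move=> oa; rewrite (weighted_sqr_harm_odd pr_p p_gt3 unitZ dt a_gt0 a_ltp oa) !mulr0.
transitivity (- (x * (p%:R * beta) * (2 * t%:R * g * l))); last by ring.
by rewrite (beta_mod_p pr_p p_gt3 unitZ p4) mul0r oppr0.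
Qed.

Let unit6 : (6 : R) \is a GRing.unit.
Proof.
have -> : (6 : R) = 2 * 3 by rewrite -natrM.
by rewrite unitrM (unit2 p_gt3 unitZ) (unit3 p_gt3 unitZ).
Qed.

Lemma even_half_t m : a = m.*2 -> exists s, t = s.*2.
Proof.
move=> am; exists t./2; have := odd_double_half t.
have := congr1 odd dt; rewrite am oddD !oddM odd_double (odd_p pr_p p_gt3) /=.
by move=> <-.
Qed.

Lemma odd_half_t : odd a -> exists u, t = u.*2.+1.
Proof.
move=> oa; exists t./2; have := odd_double_half t.
have := congr1 odd dt; rewrite oddD !oddM oa (odd_p pr_p p_gt3) /=.
by move=> <-.
Qed.

Lemma congruence_small_even : ~~ odd a -> (3 * a < 2 * p)%N ->
  x * S = x * (2 * g * h).
Proof.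
move=> ea ap; have := odd_double_half a; rewrite (negbTE ea) add0n => /esym am.
have [s ts] := even_half_t am.
have e0 := dixon_eval_small_even pr_p p_gt3 unitZ dt a_gt0 a_ltp 0 am ts ap.
have e1 := dixon_eval_small_even pr_p p_gt3 unitZ dt a_gt0 a_ltp 1 am ts ap.
rewrite !mulr0 in e0; rewrite mulr1 in e1.
apply: (mulrI unit6); rewrite (dixon_first_order (L1 := 0) e0) /=; first by ring.
  by rewrite mulr0 addr0.
exact: (quadratic_even am e0).
Qed.

Lemma congruence_big_even : ~~ odd a -> (2 * p <= 3 * a)%N ->
  x * S = x * (g * (- 1 + p%:R * (2 - 3 * t%:R) * h)).
Proof.
move=> ea ap; have := odd_double_half a; rewrite (negbTE ea) add0n => /esym am.
have [s ts] := even_half_t am.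
have e0 := dixon_eval_big_even pr_p p_gt3 unitZ dt a_gt0 a_ltp 0 am ts ap.
have e1 := dixon_eval_big_even pr_p p_gt3 unitZ dt a_gt0 a_ltp 1 am ts ap.
rewrite !mulr0 in e0; rewrite mulr1 in e1.
(* The left-over factor is [2 (p - 3 p s + 3 xi)]: its value at [0] is [p (2 - 3 t)] and its
   derivative is 6. *)
apply: (mulrI unit6); rewrite (dixon_first_order (L1 := 6) e0) /=.
- rewrite ts -muln2 natrM !(rmorphM, rmorphB, rmorphD, rmorph0, rmorph_nat) /=.
  by ring.
- rewrite e1 !(rmorphM, rmorphB, rmorphD, rmorph0, rmorph_nat) /=; congr (_ * _).
  by ring.
exact: (quadratic_even am e0).
Qed.

Lemma congruence_small_odd : odd a -> (3 * a < p)%N ->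
  x * S = x * (g * (- 3^-1 + p%:R * t%:R * h)).
Proof.
move=> oa ap.
have e0 := dixon_eval_small_odd pr_p p_gt3 unitZ dt a_gt0 a_ltp 0 oa ap.
have e1 := dixon_eval_small_odd pr_p p_gt3 unitZ dt a_gt0 a_ltp 1 oa ap.
rewrite !mulr0 in e0; rewrite mulr1 in e1.
have el : (p%:Z * t%:Z + 0)%:~R = p%:R * t%:R :> R by rewrite addr0 intr_p.
rewrite el in e0.
apply: (mulrI unit6); rewrite (dixon_first_order (L1 := 2) e0) /=.
- have e3 : 3 * 3^-1 = 1 :> R by rewrite divrr // (unit3 p_gt3 unitZ).
  transitivity (x * (g * (- 2 * (3 * 3^-1) + 6 * p%:R * t%:R * h))); last by ring.
  by rewrite e3; ring.
- rewrite e1 !(rmorphM, rmorphD, rmorph_nat) /=; congr (_ * _).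
  by ring.
exact: quadratic_odd.
Qed.

Lemma congruence_big_odd : odd a -> (p <= 3 * a)%N ->
  x * S = x * (- (p%:R * g / 6)).
Proof.
move=> oa ap; have [u tu] := odd_half_t oa.
have e0 := dixon_eval_big_odd pr_p p_gt3 unitZ dt a_gt0 a_ltp 0 oa tu ap.
have e1 := dixon_eval_big_odd pr_p p_gt3 unitZ dt a_gt0 a_ltp 1 oa tu ap.
rewrite !mulr0 in e0; rewrite mulr1 in e1.
pose l : R := - (p%:R * t%:R * (1 + 3 * u%:R)).
have el : ((p%:Z * t%:Z + 0) * (- (p%:Z * (1 + 3 * u%:Z)) + 0))%:~R = p%:R * l :> R.
  rewrite /l !addr0 !(rmorphM, rmorphN, rmorphD, rmorph_nat, rmorph1) /=; ring.
rewrite el in e0.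
(* The derivative at [0] of the two divisible factors is [p (3 t - 2 (1 + 3 u)) = p], because
   [t = 2 u + 1]. Their value at [0] is a multiple of [p ^ 2] and drops out. *)
apply: (mulrI unit6); rewrite (dixon_first_order (L1 := p%:R) e0) /=.
- transitivity (- (x * p%:R * g * (6 / 6)) +
    p%:R ^+ 4 * (- 6 * g * h * t%:R * (1 + 3 * u%:R))); first by rewrite divrr //= /l; ring.
  by rewrite p4 mul0r addr0; ring.
- rewrite e1 -el tu !(rmorphM, rmorphN, rmorphD, rmorph_nat) /=; congr (_ * _).
  apply/eqP; rewrite -subr_eq0; apply/eqP.
  by transitivity (x * x * 6 : R); [rewrite -muln2; ring | rewrite (xx0 p4) mul0r].
exact: quadratic_odd.
Qed.

End Congruence.

(** * Reduction of p-adic integers modulo p ^ 4 *)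

(** Indices are shifted by one, so [n = 3] is reduction modulo [p ^ 4]. *)
Definition padic_reduction p n (y : padic_int p) : 'Z_(p ^ n.+1) := y n.

Arguments padic_reduction : simpl never.

Fact padic_reduction_zmod p n : zmod_morphism (@padic_reduction p n).
Proof. by move=> y z; rewrite /padic_reduction padic_coordD padic_coordN. Qed.

Fact padic_reduction_monoid p n : monoid_morphism (@padic_reduction p n).
Proof. by split=> [|y z]; rewrite /padic_reduction ?padic_coord1 ?padic_coordM. Qed.

HB.instance Definition _ p n := GRing.isZmodMorphism.Build _ _ (@padic_reduction p n)
  (@padic_reduction_zmod p n).
HB.instance Definition _ p n := GRing.isMonoidMorphism.Build _ _ (@padic_reduction p n)
  (@padic_reduction_monoid p n).

Lemma residue_unique (q r s : nat) (k : int) :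
  s%:Z = r%:Z + q%:Z * k -> (r < q)%N -> (s < q)%N -> s = r.
Proof.
move=> e rq sq; have : (s%:Z %% q = r%:Z %% q)%Z by rewrite e addrC mulrC modzMDl.
by rewrite !modz_nat !modn_small // => -[].
Qed.

(** * [Gamma_p] and harmonic sums at integers, modulo [p ^ 4] *)

Section Instance.
Variable p : nat.
Hypothesis pr_p : prime p.
Hypothesis p_gt3 : (3 < p)%N.
Local Notation R := ('Z_(p ^ 4)).
Local Notation phi := (@padic_reduction p 3).
Local Notation x := ((p%:R : R) ^+ 2).

Lemma Zpow_unit (z : int) : ~~ (p %| z)%Z -> (z%:~R : R) \is a GRing.unit.
Proof.
case: z => n; rewrite dvdzE /= => pn; first by rewrite (padic_Zunit pr_p 3).
by rewrite NegzE rmorphN unitrN /= (padic_Zunit pr_p 3).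
Qed.

Lemma Zpow_p4 : (p%:R : R) ^+ 4 = 0.
Proof. by rewrite -natrX; apply: ord_inj; rewrite (Zp_natE pr_p) modnn. Qed.

(** Multiplication by [p ^ 2] in [Z / p ^ 4] kills exactly the multiples of [p ^ 2]. *)
Lemma reduction_eqmod (y z : padic_int p) :
  x * phi y = x * phi z -> padic_eqmod (p ^ 2) y z.
Proof.
move=> e; suff [w ew] : padic_eqmod (p ^ 2) (y - z) 0 by exists w; rewrite -ew subr0.
apply/(padic_eqmodP pr_p); rewrite padic_coord0 mod0n.
have : x * phi (y - z) = 0 by rewrite rmorphB mulrBr e subrr.
rewrite -natrX => /(congr1 (@nat_of_ord _)); rewrite (Zq_mul pr_p) (Zp_natE pr_p).
rewrite modnMml /padic_reduction => /eqP; rewrite -/(dvdn _ _).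
rewrite -(padic_coord_mod pr_p (y - z) (leqnSn 2)) modn_dvdm ?dvdn_exp2l //.
move: (nat_of_ord _) => v.
have e4 : (p ^ 4 = p ^ 2 * p ^ 2)%N by rewrite -expnD.
rewrite e4 dvdn_pmul2l ?expn_gt0 ?prime_gt0 //.
by move/eqP.
Qed.

Lemma reduction_coord (y z : padic_int p) n : (n <= 3)%N -> phi y = phi z -> y n = z n.
Proof.
move=> n3 e; apply: ord_inj.
rewrite -(padic_coord_mod pr_p y n3) -(padic_coord_mod pr_p z n3).
by move: e; rewrite /padic_reduction => ->.
Qed.

Lemma reduction_res (y z : padic_int p) n :
  (n <= 3)%N -> phi y = phi z -> padic_res n y = padic_res n z.
Proof. by move=> n3 e; rewrite /padic_res (reduction_coord n3 e). Qed.

Lemma eqmod_dvdz n (z : int) : padic_eqmod (p ^ n) (z%:~R : padic_int p) 0 ->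
  ((p ^ n)%N %| z)%Z.
Proof.
have natcase (k : nat) : padic_eqmod (p ^ n) (k%:R : padic_int p) 0 -> (p ^ n %| k)%N.
  move/(padic_eqmodP pr_p); rewrite padic_coord0 mod0n padic_coord_nat (Zp_natE pr_p).
  by rewrite modn_dvdm ?dvdn_exp2l // => /eqP.
case: z => k; rewrite dvdzE /=; first exact: natcase.
case=> w e; apply: natcase; exists (- w); move: e.
by rewrite NegzE rmorphN /= !subr0 mulrN => <-; rewrite opprK.
Qed.

Lemma res_int n (z : int) :
  exists w, z = (padic_res n (z%:~R : padic_int p))%:Z + (p ^ n)%N%:Z * w.
Proof.
have [_ [w e]] := padic_resP pr_p n (z%:~R : padic_int p).
set r := padic_res n _ in e *.
have /dvdzP [v ev] : ((p ^ n)%N %| z - r%:Z)%Z.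
  by apply: eqmod_dvdz; exists w; rewrite subr0 rmorphB /= -e.
by exists v; rewrite mulrC -ev addrC subrK.
Qed.

(** An integer [r] near [y] carries the value by continuity; the periodicity of [morita_nat], a
    consequence of Wilson's theorem, then replaces [r] by the coordinate of [y]. *)
Lemma gamma_coord (y : padic_int p) n :
  (morita_gamma y) n = morita_nat 'Z_(p ^ n.+1) p (y n).
Proof.
have p2 : (2 < p)%N := ltnW p_gt3.
have [Cg Eg] := morita_gammaP pr_p p2.
have [m hm] := Cg y n.+1.
pose r := padic_res (maxn m n.+1) y.
have [rlt yr] := padic_resP pr_p (maxn m n.+1) y.
have weak k : (k <= maxn m n.+1)%N -> padic_eqmod (p ^ k) r%:R y.
  move=> lek; apply: padic_eqmod_sym; have [w ew] := yr.
  by exists ((p ^ (maxn m n.+1 - k))%:R * w); rewrite mulrA -natrM -expnD subnKC.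
have := hm _ (weak m (leq_maxl _ _)); rewrite Eg => e.
have e1 := weak n.+1 (leq_maxr _ _).
have coordE (u v : padic_int p) : padic_eqmod (p ^ n.+1) u v -> u n = v n.
  move=> /(padic_eqmodP pr_p) h; apply: ord_inj.
  by rewrite -(padic_coord_mod pr_p u (leqnSn n)) -(padic_coord_mod pr_p v (leqnSn n)).
rewrite -(coordE _ _ e) morita_coord; apply: (morita_nat_mod pr_p p2).
by rewrite -(coordE _ _ e1) padic_coord_nat (Zp_natE pr_p) modn_mod.
Qed.

Lemma reduction_gamma (y z : padic_int p) : phi y = phi z ->
  phi (morita_gamma y) = phi (morita_gamma z).
Proof.
by move=> e; rewrite /padic_reduction !gamma_coord (reduction_coord (leqnn 3) e).
Qed.

Let G (z : int) : R := phi (morita_gamma z%:~R).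
Let H (z : int) : R := phi (harmonic_coprime (padic_int p) p (padic_res 2 (z%:~R : padic_int p))).

Lemma morita_natS (S : comPzRingType) k :
  morita_nat S p k.+1 = - (if (p %| k)%N then 1 else k%:R) * morita_nat S p k.
Proof.
rewrite /morita_nat exprS; case: k => [|k].
  by rewrite dvdn0 !big_nil /=; ring.
rewrite [in LHS]big_mkcond big_nat_recr //= -big_mkcond.
by case: (p %| k.+1)%N => /=; rewrite ?mulr1; ring.
Qed.

Lemma gamma_int_succ z : G (z + 1) = - (coprime_factor p z)%:~R * G z.
Proof.
have p2 : (2 < p)%N := ltnW p_gt3.
rewrite /G /padic_reduction !gamma_coord; set k := (z%:~R : padic_int p) 3%N.
have ek : (k%:R : R) = z%:~R by rewrite natr_Zp /k; exact: (rmorph_int phi z).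
have -> : ((z + 1)%:~R : padic_int p) 3%N = (k.+1)%:R :> R.
  transitivity (phi (z + 1)%:~R); first by [].
  by rewrite rmorph_int rmorphD /= -ek natr1.
rewrite (_ : morita_nat _ _ (k.+1%:R : R) = morita_nat R p k.+1); last first.
  by apply: (morita_nat_mod pr_p p2 (n := 3)); rewrite (Zp_natE pr_p) modn_mod.
rewrite morita_natS; congr (- _ * _).
have pkz : (p %| k)%N = (p %| z)%Z.
  apply: negb_inj; rewrite -(padic_Zunit pr_p 3) ek.
  apply/idP/idP => [u|]; last exact: Zpow_unit.
  apply/negP => /dvdzP [w ew]; move: u; rewrite ew rmorphM /= => u.
  have : (w%:~R * p%:R : R) ^+ 4 = 0 by rewrite exprMn Zpow_p4 mulr0.
  move=> h; have := unitrX 4 u; rewrite h unitr0 //.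
rewrite pkz /coprime_factor; case: ifP => _ //.
Qed.

Local Notation N := (coprime_harm p R).

Lemma reduction_inv_nat k : ~~ (p %| k)%N -> phi k%:R^-1 = k%:R^-1.
Proof. by move=> pk; rewrite rmorphV ?(padic_nat_unit pr_p) // rmorph_nat. Qed.

Lemma reduction_harmonic_coprime n :
  phi (harmonic_coprime (padic_int p) p n) = N 1 n.
Proof.
rewrite /harmonic_coprime rmorph_sum /= big_mkcond big_add1 /=.
apply: eq_bigr => i _; rewrite /coprime_inv.
change ((if ~~ (p %| i.+1)%N then phi i.+1%:R^-1 else 0) =
  if (p %| i.+1)%N then 0 else i.+1%:R^-1).
by case: (boolP (p %| i.+1)%N) => //= pi; exact: reduction_inv_nat.
Qed.

(** The residue modulo [p ^ 2] grows by one unless it wraps to [0]; in that case the sum over [p]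
    whole blocks vanishes modulo [p ^ 2] by Wolstenholme's theorem. *)
Lemma harmonic_int_succ z : x * H (z + 1) = x * (H z + coprime_inv p R (z + 1)).
Proof.
rewrite /H !reduction_harmonic_coprime.
have [w ew] := res_int 2 z; have [v ev] := res_int 2 (z + 1).
have [r1 _] := padic_resP pr_p 2 (z%:~R : padic_int p).
have [r2 _] := padic_resP pr_p 2 ((z + 1)%:~R : padic_int p).
move: ew ev r1 r2; set r := padic_res 2 _; set s := padic_res 2 _ => ew ev r1 r2.
have nuE : x * coprime_inv p R (z + 1) = x * coprime_inv p R r.+1%:Z.
  have -> : z + 1 = r.+1%:Z + p%:Z * (p%:Z * w).
    by rewrite {1}ew mulrA -PoszM -[(p * p)%N]/(p ^ 2)%N; lia.
  rewrite (coprime_inv_shift Zpow_unit) ?dvd_pM //; last exact: (pp_shift Zpow_p4).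
  rewrite mulrBr !intr_p; transitivity (x * coprime_inv p R r.+1%:Z -
    (p%:R : R) ^+ 4 * (w%:~R * coprime_inv p R r.+1%:Z ^+ 2)); first by ring.
  by rewrite Zpow_p4 mul0r subr0.
have NS n : N 1 n.+1 = N 1 n + coprime_inv p R n.+1%:Z.
  by rewrite /coprime_harm big_nat_recr.
have [rs|rs] := ltnP r.+1 (p ^ 2).
  have -> : s = r.+1.
    by apply: (@residue_unique (p ^ 2) _ _ (w - v)) => //; lia.
  by rewrite NS !mulrDr nuE.
have -> : s = 0%N.
  by apply: (@residue_unique (p ^ 2) _ _ (w + 1 - v)); lia.
rewrite mulrDr nuE -mulrDr -NS (_ : r.+1 = (p * p)%N); last by rewrite mulnn; lia.
rewrite (harm_blocks pr_p p_gt3 Zpow_unit Zpow_p4) (harm_full pr_p p_gt3 Zpow_unit Zpow_p4).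
by rewrite /coprime_harm big_nil !mulr0.
Qed.

Lemma harmonic_int0 : x * H 0 = 0.
Proof.
rewrite /H reduction_harmonic_coprime /padic_res /= mod0n.
by rewrite /coprime_harm big_nil mulr0.
Qed.

Lemma gamma_int0 : G 0 = 1.
Proof.
have [_ Eg] := morita_gammaP pr_p (ltnW p_gt3).
rewrite /G -[0%:~R]/(0%:R) Eg /morita_nat big_geq //= mulr1.
exact: (rmorph1 phi).
Qed.

Lemma gamma_int_unit z : G z \is a GRing.unit.
Proof. by rewrite rmorph_unit // (morita_gamma_unit pr_p (ltnW p_gt3)). Qed.

Variable alpha : padic_int p.
Hypothesis alpha_unit : ~ padic_eqmod p alpha 0.
Let a := padic_res 1 (- alpha).
(** A natural number congruent to [alpha / 2] modulo [p ^ 4], so that all arguments become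
    integers. *)
Let delta : nat := (alpha / 2%:R) 3%N.
Local Notation d := (delta%:Z).
Let t := ((2 * delta + a) %/ p)%N.

Let u2 : (2%:R : padic_int p) \is a GRing.unit.
Proof. by rewrite (padic_nat_unit pr_p) gtnNdvd // ltnW. Qed.

Lemma reduction_half : phi (alpha / 2%:R) = d%:~R.
Proof. exact/esym/natr_Zp. Qed.

Lemma reduction_alpha : phi alpha = (2 * d)%:~R.
Proof.
transitivity (phi (alpha / 2%:R) * phi 2%:R); first by rewrite -rmorphM mulrVK.
by rewrite reduction_half rmorph_nat rmorphM mulrC.
Qed.

Lemma res_ltp : (a < p)%N.
Proof. by have [h _] := padic_resP pr_p 1 (- alpha). Qed.

Lemma res_gt0 : (0 < a)%N.
Proof.
rewrite lt0n; apply/eqP => a0; apply: alpha_unit.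
have [_] := padic_resP pr_p 1 (- alpha); rewrite -/a a0 expn1 => -[w ew].
by exists (- w); rewrite mulrN -ew !subr0 opprK.
Qed.

Lemma delta_res : (2 * delta + a = p * t)%N.
Proof.
rewrite /t [in RHS]mulnC divnK //.
have [w] := res_int 1 (- (2 * d)).
rewrite -(@reduction_res (- alpha)) // ?rmorphN ?rmorph_int /= ?reduction_alpha //.
rewrite -/a expn1 => e; have : (p %| (2 * delta + a)%N%:Z)%Z.
  by apply/dvdzP; exists (- w); lia.
by rewrite dvdzE.
Qed.

(** In the congruences [alpha_star] occurs multiplied by [p], so this identity lets [t] replace
    it. *)
Lemma star_mod : (p%:R : R) * phi (padic_star alpha) = p%:R * t%:R.
Proof.
rewrite -natrM -delta_res natrD natrM -[p%:R](rmorph_nat phi) -rmorphM.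
rewrite (padic_starP pr_p) rmorphD /= rmorph_nat reduction_alpha rmorphM.
by [].
Qed.

Lemma reduction_g : phi (g_p alpha) =
  G (1 + d) * G (1 - 3 * d) / (G (1 + 2 * d) * G (1 - 2 * d) * G (1 - d) ^+ 2).
Proof.
have ug (y : padic_int p) : morita_gamma y \is a GRing.unit.
  exact: (morita_gamma_unit pr_p (ltnW p_gt3)).
have e3 : phi (3%:R * alpha / 2%:R) = (3 * d)%:~R.
  by rewrite -mulrA rmorphM /= reduction_half rmorph_nat rmorphM.
have gE (y : padic_int p) (z : int) : phi y = z%:~R -> phi (morita_gamma y) = G z.
  by move=> e; apply: reduction_gamma; rewrite rmorph_int.
rewrite /g_p rmorphM rmorphV; last by rewrite !unitrM !ug.
rewrite !rmorphM /=.
rewrite (gE _ (1 + d)); last by rewrite !rmorphD !rmorph1 /= reduction_half.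
rewrite (gE _ (1 - 3 * d)); last by rewrite !rmorphB !rmorph1 /= e3.
rewrite (gE _ (1 + 2 * d)); last by rewrite !rmorphD !rmorph1 /= reduction_alpha.
rewrite (gE _ (1 - 2 * d)); last by rewrite !rmorphB !rmorph1 /= reduction_alpha.
by rewrite (gE _ (1 - d)) // !rmorphB !rmorph1 /= reduction_half.
Qed.

Lemma reduction_h : phi (h_p alpha) =
  H (- (2 * d)) + 2^-1 * H (- d) - 2^-1 * H (- (3 * d)).
Proof.
have e3 : phi (3%:R * alpha / 2%:R) = (3 * d)%:~R.
  by rewrite -mulrA rmorphM /= reduction_half rmorph_nat rmorphM.
have hE (y : padic_int p) (z : int) : phi y = z%:~R ->
    padic_res 2 y = padic_res 2 (z%:~R : padic_int p).
  by move=> e; apply: reduction_res => //; rewrite rmorph_int.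
rewrite /h_p rmorphB rmorphD !rmorphM rmorphV // rmorph_nat /=.
rewrite (hE (- alpha) (- (2 * d))); last by rewrite !rmorphN /= reduction_alpha.
rewrite (hE (- (alpha / 2%:R)) (- d)); last by rewrite !rmorphN /= reduction_half.
by rewrite (hE (- (3%:R * alpha / 2%:R)) (- (3 * d))) // !rmorphN /= e3.
Qed.

Lemma harmonic_coprime_small k : (k < p)%N ->
  harmonic (padic_int p) k = harmonic_coprime (padic_int p) p k.
Proof.
move=> kp; rewrite /harmonic /harmonic_coprime [in RHS]big_mkcond.
apply: eq_big_nat => j /andP[j0 jk].
by rewrite gtnNdvd // (leq_ltn_trans _ kp).
Qed.

Lemma reduction_harmonic_term k : (k < p)%N ->
  phi (pochhammer alpha k ^+ 3 / k`!%:R ^+ 3 * harmonic (padic_int p) k)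
  = harmonic_term R delta k * N 1 k.
Proof.
move=> kp; have uk : (k`!%:R : padic_int p) \is a GRing.unit.
  have := fact_unit pr_p Zpow_unit kp.
  by rewrite (padic_nat_unit pr_p) (padic_Zunit pr_p 3).
rewrite harmonic_coprime_small // rmorphM /= reduction_harmonic_coprime.
congr (_ * _); rewrite rmorphM rmorphV ?unitrX //= !rmorphXn /= rmorph_nat.
rewrite (rmorph_pochhammer phi) /= reduction_alpha.
by rewrite /harmonic_term -(rmorph_pochhammer (intmul 1)).
Qed.

(** The Pochhammer symbol contains [2 d + a = p t], and its cube contributes [p ^ 3]. *)
Lemma harmonic_term_big k : (a < k)%N -> x * harmonic_term R delta k = 0.
Proof.
move=> ak; rewrite /harmonic_term /pochhammer.
rewrite (bigD1_seq a) ?iota_uniq ?mem_index_iota //= rmorphM /=.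
have -> : 2 * d + a%:R = (p * t)%N%:Z by rewrite -delta_res natz; lia.
rewrite -[(p * t)%N%:Z%:~R]/((p * t)%N%:R) natrM; set c := _%:~R.
transitivity ((p%:R : R) ^+ 4 * (p%:R * (t%:R * c) ^+ 3 / k`!%:R ^+ 3)); first by ring.
by rewrite Zpow_p4 mul0r.
Qed.

Lemma reduction_harmonic_sum : x * phi (harmonic_sum alpha) =
  x * \sum_(0 <= k < a.+1) harmonic_term R delta k * N 1 k.
Proof.
rewrite /harmonic_sum rmorph_sum /= !mulr_sumr.
rewrite (big_cat_nat (n := a.+1)) //= ?res_ltp //.
rewrite addrC big_nat big1 => [|k /andP[ak kp]].
  (* The extra term [k = 0] has an empty harmonic sum. *)
  rewrite add0r [RHS]big_ltn // [X in X + _](_ : _ = 0) ?add0r; last first.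
    by rewrite /coprime_harm big_nil !mulr0.
  apply: eq_big_nat => k /andP[k0 ka].
  by rewrite reduction_harmonic_term // (leq_trans ka) // res_ltp.
by rewrite reduction_harmonic_term // mulrA harmonic_term_big // mul0r.
Qed.

End Instance.

(** * The four cases, lifted from [Z / p ^ 4] to the p-adic integers *)

Theorem theorem10p1 (p : nat) (p_prime : prime p) (p_gt3 : (3 < p)%N)
    (alpha : padic_int p) (alpha_unit : ~ padic_eqmod p alpha 0) :
  let a := padic_res 1 (- alpha) in
  let S := harmonic_sum alpha in
  let g := g_p alpha in
  let h := h_p alpha in
  let alpha_star := padic_star alpha in
  [/\ ~~ odd a -> (3 * a < 2 * p)%N ->
        padic_eqmod (p ^ 2) S (2%:R * g * h),
      ~~ odd a -> (2 * p <= 3 * a)%N ->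
        padic_eqmod (p ^ 2) S
          (g * (- 1 + p%:R * (2%:R - 3%:R * alpha_star) * h)),
      odd a -> (3 * a < p)%N ->
        padic_eqmod (p ^ 2) S (g * (- 3%:R^-1 + p%:R * alpha_star * h)) &
      odd a -> (p <= 3 * a)%N ->
        padic_eqmod (p ^ 2) S (- (p%:R * g / 6%:R))].
Proof.
move=> a S g h alpha_star.
have Sred := reduction_harmonic_sum p_prime p_gt3 alpha.
have gred := reduction_g p_prime p_gt3 alpha.
have hred := reduction_h p_prime p_gt3 alpha.
have star := star_mod p_prime p_gt3 alpha.
have dt := delta_res p_prime p_gt3 alpha.
have a0 := res_gt0 p_prime alpha_unit.
have ap := res_ltp p_prime alpha.
have uZ := Zpow_unit p_prime; have p4 := Zpow_p4 p_prime.
pose G (z : int) := padic_reduction 3 (@morita_gamma p z%:~R).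
pose H (z : int) := padic_reduction 3
  (harmonic_coprime (padic_int p) p (padic_res 2 (z%:~R : padic_int p))).
have G0 : G 0 = 1 := gamma_int0 p_prime p_gt3.
have GS : forall z, G (z + 1) = _ := gamma_int_succ p_prime p_gt3.
have uG : forall z, G z \is a GRing.unit := gamma_int_unit p_prime p_gt3.
have H0 : _ * H 0 = 0 := harmonic_int0 p_prime.
have HS : forall z, _ * H (z + 1) = _ * (H z + _) := harmonic_int_succ p_prime p_gt3.
rewrite -!/(G _) in gred; rewrite -!/(H _) in hred.
have unat k : (0 < k < 4)%N -> (k%:R : padic_int p) \is a GRing.unit.
  by case/andP=> k0 k4; rewrite padic_nat_unit // gtnNdvd // (leq_trans k4).
rewrite /g /h /alpha_star {g h alpha_star}.
have ce1 := congruence_small_even p_prime p_gt3 uZ p4 dt a0 ap G0 GS uG H0 HS.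
have ce2 := congruence_big_even p_prime p_gt3 uZ p4 dt a0 ap G0 GS uG H0 HS.
have co1 := congruence_small_odd p_prime p_gt3 uZ p4 dt a0 ap G0 GS uG H0 HS.
have co2 := congruence_big_odd p_prime p_gt3 uZ p4 dt a0 ap G0 GS uG H0 HS.
rewrite -gred -hred -Sred in ce1 ce2 co1 co2.
move: ce1 ce2 co1 co2 star; rewrite -/S -/a {gred hred Sred}.
move: (g_p alpha) (h_p alpha) (padic_star alpha) => g h alpha_star ce1 ce2 co1 co2 star.
split=> oa ha; apply: (reduction_eqmod p_prime).
- by rewrite ce1 // !rmorphM rmorph_nat.
- rewrite ce2 // !(rmorphM, rmorphD, rmorphN, rmorph1, rmorph_nat) /=.
  congr (_ * (_ * (_ + _ * _))).
  by rewrite !mulrBr !(mulrCA p%:R) star.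
- rewrite co1 // -star !(rmorphM, rmorphD, rmorphN) /= rmorphV ?unat //.
  by rewrite !rmorph_nat.
- rewrite co2 //.
  have u6 : (6%:R : padic_int p) \is a GRing.unit.
    by rewrite -[6%N]/(2 * 3)%N natrM unitrM !unat.
  by rewrite !(rmorphN, rmorphM) /= rmorphV // !rmorph_nat.
Qed.
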